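(* Let $\mu$ be an increasing sequence of positive integers, let $(\alpha_n)_{n\geq 0}$ be a sequence of non-zero complex numbers and let $R\in[0,+\infty]$ be the radius of convergence of the power series $\sum_{n\geq 0}\frac{z^n}{n!|\alpha_n|}$. Assume that, for every $r>R$, we have $r^n/(|\alpha_n|n!)\rightarrow+\infty$ as $n\rightarrow+\infty$. Let $f\in\mathcal{W}_R^{(\mu)}(\alpha_n)$. Then the radius of convergence of the Taylor development of $f$ at $0$ is equal to $R$.
   Context: For $r\in(0,+\infty]$, $\mathbb{D}_r=\{z\in\mathbb{C}:|z|<r\}$ (with $\mathbb{D}_\infty=\mathbb{C}$) and $\mathcal{H}(\mathbb{D}_r)$ is the space of holomorphic functions on $\mathbb{D}_r$; $\mathcal{H}(\mathbb{D}_0)$ is the space of formal power series. $S_n(g)$ is the $n$-th partial sum of the Taylor development of $g$ at $0$; thus for $f=\sum_k a_kz^k$ (convergent or formal), $S_n(f^{(n)})(z)=\sum_{k=n}^{2n}a_k\frac{k!}{(k-n)!}z^{k-n}$. $\mathcal{W}_R^{(\mu)}(\alpha_n)$ is the set of $f\in\mathcal{H}(\mathbb{D}_R)$ such that, for every compact subset $K$ of $\mathbb{C}$ with $\mathbb{C}\setminus K$ connected, and every function $h$ continuous on $K$ and holomorphic in the interior of $K$, there exists an increasing subsequence $(\lambda_n)_n\subset\mu$ such that $\sup_{z\in K}\left|\alpha_{\lambda_n}S_{\lambda_n}(f^{(\lambda_n)})(z)-h(z)\right|\to 0$ as $n\to+\infty$. *)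

(* Defs.v *)
From HB Require Import structures.
From mathcomp Require Import all_boot all_order all_algebra complex.
From mathcomp Require Import boolp classical_sets reals ereal.
From mathcomp Require Import topology normedtype sequences derive.

Set Implicit Arguments.
Unset Strict Implicit.
Unset Printing Implicit Defensive.

Import Order.TTheory GRing.Theory Num.Theory.
Import Normc numFieldTopology.Exports numFieldNormedType.Exports.

Local Open Scope complex_scope.
Local Open Scope ring_scope.
Local Open Scope classical_set_scope.

Set Warnings "-redundant-canonical-projection".
(* The usual topology of the complex plane: R[i] as a normed space over itself.
   Consequently [derivable f z 1] is complex differentiability at z. *)
HB.instance Definition _ (R : realType) := GRing.ComAlgebra.copy R[i] R[i]^o.
HB.instance Definition _ (R : realType) := NormedModule.copy R[i] R[i]^o.

Definition disc (R : realType) (r : \bar R) : set R[i] :=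
  [set z | ((normc z)%:E < r)%E].

Definition holomorphic_on (R : realType) (U : set R[i]) (f : R[i] -> R[i]) :=
  forall z, U z -> derivable f z 1.

(* z = 0 always belongs to the set, so that the radius is in [0, +oo]. *)
Definition conv_radius (R : realType) (a : nat -> R[i]) : \bar R :=
  ereal_sup [set (normc z)%:E | z in [set z | cvgn [series a n * z ^+ n]_n]].

(* The space H(D_r), 0 <= r <= +oo. For r > 0 an element is represented by a
   total function, whose values outside the disc are irrelevant. *)
Inductive hol_disc (R : realType) (r : \bar R) : Type :=
| HolFormal of r = 0%E & nat -> R[i]
| HolFun (f : R[i] -> R[i]) of (0 < r)%E & holomorphic_on (disc r) f.

Definition formal_derive (R : realType) (a : nat -> R[i]) : nat -> R[i] :=
  fun k => a k.+1 *+ k.+1.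

(* Taylor coefficients at 0 of the n-th derivative of f. *)
Definition taylor_derive (R : realType) (r : \bar R) (f : hol_disc r) (n : nat)
    : nat -> R[i] :=
  match f with
  | HolFormal _ a => iter n (@formal_derive R) a
  | HolFun f _ _ => fun k => derive1n k (derive1n n f) 0 / k`!%:R
  end.

Definition taylor (R : realType) (r : \bar R) (f : hol_disc r) : nat -> R[i] :=
  taylor_derive f 0.

Definition partial_sum (R : realType) (a : nat -> R[i]) (n : nat) (z : R[i])
    : R[i] :=
  \sum_(k < n.+1) a k * z ^+ k.

Lemma taylor_deriveE (R : realType) (r : \bar R) (f : hol_disc r) n k :
  taylor_derive f n k = taylor f (n + k) * ((n + k)`!%:R / k`!%:R).
Proof.
have nz m : m`!%:R != 0 :> R[i] by rewrite pnatr_eq0 -lt0n fact_gt0.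
case: f => [e a|f e hf]; rewrite /taylor /taylor_derive /=; last first.
  rewrite /derive1n -iterD [(k + n)%N]addnC.
  by rewrite mulrA divfK.
elim: n k => [|n IHn] k; first by rewrite divff ?mulr1.
rewrite iterS /formal_derive IHn addnS addSn -mulrnAr -mulr_natr.
rewrite -[_ / _ * _]mulrA (factS k) natrM invfM mulrAC mulVf ?mul1r //.
Qed.

Lemma partial_sum_deriveE (R : realType) (r : \bar R) (f : hol_disc r) n z :
  partial_sum (taylor_derive f n) n z =
  \sum_(n <= k < n.*2.+1)
    taylor f k * (k`!%:R / (k - n)`!%:R) * z ^+ (k - n).
Proof.
rewrite -[X in \sum_(X <= _ < _) _]addn0 addnC big_addn -addnn -addSn addnK.
rewrite big_mkord; apply: eq_bigr => k _.
by rewrite addnK taylor_deriveE addnC.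
Qed.

(* The supremum over the empty compact set is 0, by definition of [sup]. *)
Definition universal (R : realType) (mu : nat -> nat) (alpha : nat -> R[i])
    (r : \bar R) (f : hol_disc r) : Prop :=
  forall (K : set R[i]) (h : R[i] -> R[i]),
    compact K -> connected (~` K) ->
    {within K, continuous h} -> holomorphic_on K° h ->
    exists lambda : nat -> nat,
      [/\ {homo lambda : m n / (m < n)%N},
          forall n, exists m, lambda n = mu m &
          sup [set normc (alpha (lambda n) *
                 partial_sum (taylor_derive f (lambda n)) (lambda n) z - h z)
              | z in K] @[n --> \oo] --> (0 : R)].

(* Main.v *)
(* Upper bound: universality applied to K = {0} and h = 1 makes
   alpha_n n! a_n tend to 1 along a subsequence, so that |a_n| r^n is close to
   r^n / (|alpha_n| n!) there and is unbounded for every r > R.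

   Lower bound: this is Cauchy's theorem that a complex differentiable function
   is the sum of its Taylor series on the disc. The circle gamma is contracted
   to the point z by zeta(s, t) = z + s (gamma(t) - z). Goursat's bisection of the
   rectangle of parameters (s, t) shows that the form f(zeta) dzeta / (zeta - z),
   with dzeta / (zeta - z) = ds / s + gamma' dt / (gamma - z), has integral zero
   over its boundary; letting s tend to 0 gives Cauchy's formula, and
   differentiating the kernel gives |f^(m)(0)| / m! <= C / r^m. *)
Require Import Defs.
From mathcomp Require Import all_boot all_order all_algebra complex.
From mathcomp Require Import boolp classical_sets reals ereal.
From mathcomp Require Import topology normedtype sequences derive.
From mathcomp Require Import functions measure lebesgue_measure lebesgue_integral.
From mathcomp Require Import ftc trigo.
From mathcomp Require Import ring lra.
Import Order.TTheory GRing.Theory Num.Theory.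
Import Normc numFieldTopology.Exports numFieldNormedType.Exports.
Local Open Scope complex_scope.
Local Open Scope ring_scope.
Local Open Scope classical_set_scope.

Set Implicit Arguments.
Unset Strict Implicit.
Unset Printing Implicit Defensive.

(** * Topology and differentiability of the complex plane *)

Section ComplexTopology.
Variable R : realType.
Implicit Types (z w : R[i]) (e : R).

(** Complex differentiability is pointwise and says nothing on the continuity of the derivative, so
    the integral over the contracted curve cannot be differentiated in [s] under the integral sign.
    Bisection avoids this: near a point a function is affine up to a small remainder, and affine
    functions contribute nothing to the boundary integral. The cuts are made in the parameters, so
    every piece is a rectangle and every edge integral is an integral over a real segment. The
    coefficient of [ds] blows up at [s = 0], hence the rectangles are confined to [sig <= s <= 1];
    as the curve is closed, the edges at its two ends cancel, and the integral at [s = 1] equals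
    that at [s = sig]. There remains the integral of [gamma' / (gamma - z)]; no logarithm or winding
    number evaluates it, but a second application of the same formula on an inverted circle. For the
    upper bound, the selected indices satisfy [n <= lambda n], so estimates valid for large indices
    hold along the subsequence. *)

Lemma normr_normc z : `|z| = (normc z)%:C.
Proof. by case: z. Qed.

Lemma normc_ge0 z : 0 <= normc z.
Proof. by rewrite -ler0c -normr_normc normr_ge0. Qed.

Lemma normcB z w : normc (z - w) = normc (w - z).
Proof. by rewrite -normcN opprB. Qed.

(* [le_normcD] itself is stated for the additive structure of [Rcomplex R]. *)
Lemma ler_normcD z w : normc (z + w) <= normc z + normc w.
Proof. exact: le_normcD. Qed.

Lemma normcX z n : normc (z ^+ n) = normc z ^+ n.
Proof.
by elim: n => [|n IH]; rewrite ?expr0 ?normc1// !exprS normcM IH.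
Qed.

Lemma normc_real e : normc e%:C = `|e|.
Proof. by rewrite /normc /= expr0n /= addr0 sqrtr_sqr. Qed.

Lemma normc_i : normc 'i = 1 :> R.
Proof. by rewrite /normc /= expr0n /= add0r expr1n sqrtr1. Qed.

Lemma normc_eq0 z : (normc z == 0) = (z == 0).
Proof.
by apply/eqP/eqP => [/eq0_normc//|->]; rewrite normc0.
Qed.

Lemma normc_gt0 z : (0 < normc z) = (z != 0).
Proof. by rewrite lt0r normc_ge0 andbT normc_eq0. Qed.

Lemma ReB z w : complex.Re (z - w) = complex.Re z - complex.Re w.
Proof. by case: z w => [a b] [c d]. Qed.

Lemma ImB z w : complex.Im (z - w) = complex.Im z - complex.Im w.
Proof. by case: z w => [a b] [c d]. Qed.

Lemma ler_normc_Re z : `|complex.Re z| <= normc z.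
Proof. by have := normc_ge_Re z; rewrite normr_normc lecR. Qed.

Lemma ler_normc_Im z : `|complex.Im z| <= normc z.
Proof.
by case: z => a b /=; rewrite -sqrtr_sqr ler_wsqrtr// lerDr sqr_ge0.
Qed.

Lemma normc_le_ReIm z : normc z <= `|complex.Re z| + `|complex.Im z|.
Proof.
rewrite {1}[z]complexE (le_trans (ler_normcD _ _))//.
by rewrite normcM normc_i mul1r !normc_real.
Qed.

Lemma cvg_normcP (T : Type) (F : set_system T) (FF : Filter F)
    (f : T -> R[i]) z :
  f @ F --> z <-> forall e, 0 < e -> \forall x \near F, normc (f x - z) < e.
Proof.
split.
  move=> /cvgrPdist_lt H e e0.
  have /H : 0 < e%:C by rewrite ltcR.
  by apply: filterS => x; rewrite normr_normc ltcR normcB.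
move=> H; apply/cvgrPdist_lt => -[e b]; rewrite ltcE/= => /andP[/eqP -> e0].
by have := H e e0; apply: filterS => x; rewrite -normcB normr_normc ltcR.
Qed.

Lemma nbhs_normcP z (A : set R[i]) :
  nbhs z A <-> exists2 e, 0 < e & forall w, normc (w - z) < e -> A w.
Proof.
split.
  move=> /nbhs_ballP[[e b]]; rewrite /= ltcE /= => /andP[/eqP -> e0] H.
  by exists e => // w we; apply: H; rewrite /ball /= normr_normc ltcR normcB.
move=> [e e0 H]; apply/nbhs_ballP; exists e%:C; rewrite /= ?ltcR//.
by move=> w; rewrite /ball /= normr_normc ltcR normcB; exact: H.
Qed.

Lemma cvg_ReIm (T : Type) (F : set_system T) (FF : Filter F)
    (f : T -> R[i]) z :
  f @ F --> z <-> (fun x => complex.Re (f x)) @ F --> complex.Re z /\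
                (fun x => complex.Im (f x)) @ F --> complex.Im z.
Proof.
split.
  move=> /cvg_normcP H; split; apply/cvgrPdist_lt => e /H; apply: filterS => x.
    by apply: le_lt_trans; rewrite distrC -ReB ler_normc_Re.
  by apply: le_lt_trans; rewrite distrC -ImB ler_normc_Im.
move=> [/cvgrPdist_lt H1 /cvgrPdist_lt H2]; apply/cvg_normcP => e e0.
have e20 : 0 < e / 2 by rewrite divr_gt0.
move: (H1 _ e20) (H2 _ e20); apply: filterS2 => x.
rewrite distrC => a1; rewrite distrC => a2.
rewrite (splitr e) (le_lt_trans (normc_le_ReIm _))//.
by rewrite ReB ImB ltrD.
Qed.

Lemma continuous_real_complex x : {for x, continuous (fun t : R => t%:C)}.
Proof. by apply/cvg_ReIm; split => /=; [exact: cvg_id|exact: cvg_cst]. Qed.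

(** Quotient-free form of the derivative: [w = z] is allowed and the radius is explicit, as the
    local estimate of Goursat's argument requires. *)
Definition cderiv (g : R[i] -> R[i]) z d := forall e, 0 < e ->
  exists2 r : R, 0 < r & forall w, normc (w - z) < r ->
    normc (g w - g z - d * (w - z)) <= e * normc (w - z).

Lemma derivable_cderiv (g : R[i] -> R[i]) z :
  derivable g z 1 -> exists d, cderiv g z d.
Proof.
rewrite /derivable; set l := (X in cvg X) => /cvg_ex[d] Hd; exists d => e e0.
have /(_ _ e e0) := (cvg_normcP _ _ _).1 Hd.
rewrite near_withinE => /nbhs_normcP[r r0 H].
exists r => // w wr; have [->|wz] := eqVneq w z.
  by rewrite !subrr mulr0 subrr normc0 mulr0.
have h0 : w - z != 0 by rewrite subr_eq0.
have := H (w - z); rewrite subr0 => /(_ wr h0) /ltW.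
rewrite /= /shift /= scaler1 subrK => Hle.
have -> : g w - g z - d * (w - z) =
          ((w - z)^-1 *: (g w - g z) - d) * (w - z).
  by rewrite mulrBl mulrAC mulVf// mul1r.
by rewrite normcM ler_wpM2r// normc_ge0.
Qed.

Lemma cderiv_derive1 (g : R[i] -> R[i]) z d :
  cderiv g z d -> derive1 g z = d.
Proof.
move=> Hd; rewrite /derive1; apply: cvg_lim => //.
apply/cvg_normcP => e e0; rewrite near_withinE.
have e20 : 0 < e / 2 by rewrite divr_gt0.
have [r r0 H] := Hd _ e20.
apply/nbhs_normcP; exists r => // h; rewrite subr0 => hr h0.
have := H (h + z); rewrite addrK => /(_ hr) Hle.
have -> : h^-1 *: (g (h + z) - g z) - d =
          (g (h + z) - g z - d * h) * h^-1.
  by rewrite mulrBl mulfK// mulrC.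
rewrite normcM normcV ltr_pdivrMr ?normc_gt0//.
rewrite (le_lt_trans Hle)// ltr_pM2r ?normc_gt0// ltr_pdivrMr// ltr_pMr//.
by rewrite ltr1n.
Qed.

Lemma cderiv_continuous (g : R[i] -> R[i]) z d :
  cderiv g z d -> {for z, continuous g}.
Proof.
move=> H; apply/(cvg_normcP (nbhs_filter z)) => e e0.
have [r r0 {}H] := H 1 ltr01.
pose M := 1 + normc d.
have M0 : 0 < M by rewrite ltr_wpDr ?normc_ge0.
apply/nbhs_normcP; exists (Num.min r (e / M)).
  by rewrite lt_min r0 divr_gt0.
move=> w; rewrite lt_min => /andP[/H Hle]; rewrite ltr_pdivlMr// => wM.
apply: le_lt_trans wM.
rewrite -[g w - g z](subrK (d * (w - z))) (le_trans (ler_normcD _ _))//.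
by rewrite /M [leRHS]mulrDr mulr1 normcM lerD//; [rewrite mul1r in Hle|rewrite mulrC].
Qed.

End ComplexTopology.

(** * Integrals of complex-valued functions on segments *)

Section CurveIntegral.
Variable R : realType. Implicit Types (a b c:R) (u v: R -> R).
Notation mu := (@lebesgue_measure R).

Lemma continuous_itv_integrable u a b : 
  (forall x, a <= x <= b -> {for x, continuous u}) -> mu.-integrable `[a,b] (EFin \o u).
Proof.
move=> H; apply: continuous_compact_integrable; first exact: segment_compact.
apply: continuous_in_subspaceT => x.
by rewrite inE/= in_itv/=; exact: H.
Qed.

Lemma rint_cst a b c : a <= b -> \int[mu]_(x in `[a,b]) c = (b - a) * c.
Proof.
move=> ab; rewrite Rintegral_cst//= lebesgue_measure_itv/= lte_fin.
case: ltP => [_|ba]; first by rewrite /= mulrC.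
have -> : a = b by apply: le_anti; rewrite ab.
by rewrite subrr mul0r mulr0.
Qed.

Lemma rint_split u a b c : a <= b -> b <= c -> 
  (forall x, a <= x <= c -> {for x, continuous u}) ->
  \int[mu]_(x in `[a,c]) u x = \int[mu]_(x in `[a,b]) u x + \int[mu]_(x in `[b,c]) u x.
Proof.
move=> ab bc H; have Hi := continuous_itv_integrable H.
have := @Rintegral_itvB R u (BLeft a) (BRight c) b Hi.
rewrite !bnd_simp => /(_ ab bc).
rewrite Rintegral_itv_obnd_cbnd; last first.
  apply: (integrableS _ _ _ Hi) => //=.
  by move=> x/=; rewrite !in_itv/= => /andP[h ->]; rewrite (ltW (le_lt_trans ab h)).
by move=> <-; rewrite addrC subrK.
Qed.

Lemma rint_le_norm u a b M : a <= b -> 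
  (forall x, a <= x <= b -> {for x, continuous u}) ->
  (forall x, a <= x <= b -> `|u x| <= M) ->
  `|\int[mu]_(x in `[a,b]) u x| <= (b - a) * M.
Proof.
move=> ab H HM; have Hi := continuous_itv_integrable H.
rewrite (le_trans (le_normr_Rintegral _ Hi))//.
rewrite -(rint_cst M ab); apply: le_Rintegral => //.
- exact: (integrable_norm Hi).
- by apply: continuous_itv_integrable => x _; exact: cvg_cst.
Qed.

Lemma rint_FTC u F a b : a <= b -> continuous u ->
  (forall x : R, is_derive x 1 F (u x)) ->
  \int[mu]_(x in `[a,b]) u x = F b - F a.
Proof.
rewrite le_eqVlt => /predU1P[<- _ _|ab cu dF].
  by rewrite set_itv1 Rintegral_set1 subrr.
have cF : continuous F.
  move=> x; apply: differentiable_continuous; apply/derivable1_diffP.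
  by have := @ex_derive _ _ _ _ _ _ _ (dF x).
rewrite /Rintegral (@continuous_FTC2 _ u F)//.
- exact: continuous_subspaceT.
- split => [x _| |]; first by case: (dF x).
  + by apply: cvg_at_right_filter; exact: cF.
  + by apply: cvg_at_left_filter; exact: cF.
- by move=> x _; rewrite derive1E; case: (dF x).
Qed.

Implicit Types (g : R -> R[i]) (z : R[i]).

(* A boxed predicate, so that it is never unfolded during unification. *)
Variant cont_on a b g : Prop :=
  ContOn of (forall x, a <= x <= b -> {for x, continuous g}).

Definition cint a b g : R[i] :=
  (\int[mu]_(x in `[a, b]) complex.Re (g x)) +i*
  (\int[mu]_(x in `[a, b]) complex.Im (g x)).

Lemma cont_on_Re a b g : cont_on a b g ->
  forall x, a <= x <= b -> {for x, continuous (fun t => complex.Re (g t))}.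
Proof. by move=> [H] x /H /cvg_ReIm[]. Qed.

Lemma cont_on_Im a b g : cont_on a b g ->
  forall x, a <= x <= b -> {for x, continuous (fun t => complex.Im (g t))}.
Proof. by move=> [H] x /H /cvg_ReIm[]. Qed.

Lemma cont_onD a b g1 g2 : cont_on a b g1 -> cont_on a b g2 ->
  cont_on a b (fun x => g1 x + g2 x).
Proof. by move=> [H1] [H2]; split=> x xab; apply: cvgD; [exact: H1|exact: H2]. Qed.

Lemma cont_onM a b g1 g2 : cont_on a b g1 -> cont_on a b g2 ->
  cont_on a b (fun x => g1 x * g2 x).
Proof. by move=> [H1] [H2]; split=> x xab; apply: cvgM; [exact: H1|exact: H2]. Qed.

Lemma cont_onV a b g : cont_on a b g -> (forall x, a <= x <= b -> g x != 0) ->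
  cont_on a b (fun x => (g x)^-1).
Proof. by move=> [H] H0; split=> x xab; apply: cvgV; [exact: H0|exact: H]. Qed.

Lemma cont_on_cst a b z : cont_on a b (fun=> z).
Proof. by split=> x _; exact: cvg_cst. Qed.

Lemma cont_onX a b g n : cont_on a b g -> cont_on a b (fun x => g x ^+ n).
Proof.
move=> H; elim: n => [|n IH]; first exact: cont_on_cst.
by under eq_fun do rewrite exprS; exact: cont_onM.
Qed.

Lemma cont_onS a b c d g : a <= c -> d <= b -> cont_on a b g -> cont_on c d g.
Proof.
move=> ac db [H]; split=> x /andP[cx xd]; apply: H.
by rewrite (le_trans ac cx) (le_trans xd db).
Qed.

Lemma cont_on_comp a b g (f : R[i] -> R[i]) : cont_on a b g ->
  (forall x, a <= x <= b -> {for g x, continuous f}) ->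
  cont_on a b (fun x => f (g x)).
Proof. by move=> [H] Hf; split=> x xab; apply: continuous_comp; [exact: H|exact: Hf]. Qed.

Lemma eq_cint a b g1 g2 : (forall x, a <= x <= b -> g1 x = g2 x) ->
  cint a b g1 = cint a b g2.
Proof.
by move=> H; congr (_ +i* _); apply: eq_Rintegral => x; rewrite inE/= in_itv/=;
  move=> /H ->.
Qed.

Lemma cintD a b g1 g2 : cont_on a b g1 -> cont_on a b g2 ->
  cint a b (fun x => g1 x + g2 x) = cint a b g1 + cint a b g2.
Proof.
move=> H1 H2; apply/eqP; rewrite eq_complex /=.
rewrite -!RintegralD//; try by apply: continuous_itv_integrable;
  do [exact: cont_on_Re|exact: cont_on_Im].
by apply/andP; split; apply/eqP; apply: eq_Rintegral => x _;
  case: (g1 x) (g2 x) => [? ?] [? ?].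
Qed.

Lemma cintZ a b z g : cont_on a b g ->
  cint a b (fun x => z * g x) = z * cint a b g.
Proof.
move=> H; have iRe := continuous_itv_integrable (cont_on_Re H).
have iIm := continuous_itv_integrable (cont_on_Im H).
have sc (k : R) u : mu.-integrable `[a, b] (EFin \o u) ->
    mu.-integrable `[a, b] (EFin \o (fun x => k * u x)).
  move=> iu; have -> : EFin \o (fun x => k * u x) =
      (fun x => k%:E * (EFin \o u) x)%E by apply/funext => x; rewrite /= EFinM.
    exact: integrableZl.
case: z => p q; apply/eqP; rewrite eq_complex /=.
rewrite -!RintegralZl// -RintegralB ?sc// -RintegralD ?sc//.
by apply/andP; split; apply/eqP; apply: eq_Rintegral => x _;
  case: (g x) => [? ?].
Qed.

Lemma cint_cst a b z : a <= b -> cint a b (fun=> z) = (b - a)%:C * z.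
Proof.
move=> ab; rewrite /cint !rint_cst//; case: z => p q.
by apply/eqP; rewrite eq_complex /= !mul0r subr0 addr0 !eqxx.
Qed.

Lemma cint_split a b c g : a <= b -> b <= c -> cont_on a c g ->
  cint a c g = cint a b g + cint b c g.
Proof.
move=> ab bc H; rewrite /cint (rint_split ab bc (cont_on_Re H)).
by rewrite (rint_split ab bc (cont_on_Im H)).
Qed.

(** The factor 2 comes from bounding real and imaginary parts separately; it reappears in the
    constants below. *)
Lemma cint_le a b g M : a <= b -> cont_on a b g ->
  (forall x, a <= x <= b -> normc (g x) <= M) ->
  normc (cint a b g) <= 2 * (b - a) * M.
Proof.
move=> ab H HM; rewrite (le_trans (normc_le_ReIm _))//= -mulrA mulr2n.
rewrite mulrDl !mul1r lerD//.
  apply: rint_le_norm => //; first exact: cont_on_Re.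
  by move=> x /HM; apply: le_trans; exact: ler_normc_Re.
apply: rint_le_norm => //; first exact: cont_on_Im.
by move=> x /HM; apply: le_trans; exact: ler_normc_Im.
Qed.

End CurveIntegral.

(** * Goursat's bisection *)

Section Bisection.
Variable R : realType.

Lemma half_eq (h : R) (n : nat) : h / 2 ^+ n.+1 = h / 2 ^+ n / 2.
Proof. by rewrite exprSr invfM mulrA. Qed.

Lemma nested_intervals (x w : nat -> R) : (forall n, 0 <= w n) ->
  (forall n, w n.+1 = w n / 2) ->
  (forall n, x n <= x n.+1 <= x n + w n.+1) ->
  exists X, forall n, x n <= X <= x n + w n.
Proof.
move=> w0 wS H.
(* Nesting: the right end of the interval of index [n + m] stays below that of index [n]. *)
have up n m : x n <= x (n + m)%N <= x n + w n - w (n + m)%N.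
  elim: m => [|m /andP[IH1 IH2]].
    by rewrite addn0 lexx /= -addrA subrr addr0.
  have /andP[H1 H2] := H (n + m)%N.
  rewrite addnS (le_trans IH1 H1)/= (le_trans H2)//.
  by move: IH2; rewrite wS; lra.
have ub n m : x m <= x n + w n.
  case: (leqP n m) => [nm|/ltnW mn].
    by have /andP[_] := up n (m - n)%N; rewrite subnKC//; move: (w0 m); lra.
  by have /andP[+ _] := up m (n - m)%N; rewrite subnKC//; move: (w0 n); lra.
exists (sup (range x)) => n; apply/andP; split.
  apply: ub_le_sup; last by exists n.
  by exists (x 0%N + w 0%N) => _ [m _ <-].
by apply: ge_sup; [exists (x 0%N), 0%N|move=> _ [m _ <-]].
Qed.

(* [x2 - x1 + y2 - y1] is halved and its square is divided by four when a
   rectangle is cut into four: one of the pieces violates the bound if the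
   whole rectangle does. *)
Lemma subadditive_rect_le0 (N : R -> R -> R -> R -> R) (a b c d : R) :
  a <= b -> c <= d ->
  (forall x1 x2 x3 y1 y2, a <= x1 -> x1 <= x2 -> x2 <= x3 -> x3 <= b ->
     c <= y1 -> y1 <= y2 -> y2 <= d ->
     N x1 x3 y1 y2 <= N x1 x2 y1 y2 + N x2 x3 y1 y2) ->
  (forall x1 x2 y1 y2 y3, a <= x1 -> x1 <= x2 -> x2 <= b ->
     c <= y1 -> y1 <= y2 -> y2 <= y3 -> y3 <= d ->
     N x1 x2 y1 y3 <= N x1 x2 y1 y2 + N x1 x2 y2 y3) ->
  (forall x y e, a <= x <= b -> c <= y <= d -> 0 < e ->
     exists2 r, 0 < r & forall x1 x2 y1 y2,
       a <= x1 -> x1 <= x <= x2 -> x2 <= b ->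
       c <= y1 -> y1 <= y <= y2 -> y2 <= d ->
       x2 - x1 < r -> y2 - y1 < r ->
       N x1 x2 y1 y2 <= e * (x2 - x1 + (y2 - y1)) ^+ 2) ->
  N a b c d <= 0.
Proof.
move=> ab cd Nx Ny Nloc.
suff H e : 0 < e -> N a b c d <= e * (b - a + (d - c)) ^+ 2.
  apply/ler_addgt0Pr => e e0; rewrite add0r.
  pose D := (b - a + (d - c)) ^+ 2.
  have D0 : 0 < 1 + D by rewrite ltr_pwDl// sqr_ge0.
  (* [1 + D] instead of [D], since the rectangle may be a point. *)
  rewrite (le_trans (H (e / (1 + D)) _)) ?divr_gt0//.
  by rewrite -/D mulrAC ler_pdivrMr// ler_pM2l// lerDr.
move=> e0; rewrite leNgt; apply/negP => bad.
pose h := b - a; pose k := d - c.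
have h0 : 0 <= h by rewrite subr_ge0.
have k0 : 0 <= k by rewrite subr_ge0.
pose P n (p : R * R) := [/\ a <= p.1, p.1 + h / 2 ^+ n <= b,
  c <= p.2, p.2 + k / 2 ^+ n <= d &
  e * (h / 2 ^+ n + k / 2 ^+ n) ^+ 2 <
  N p.1 (p.1 + h / 2 ^+ n) p.2 (p.2 + k / 2 ^+ n)].
(* The premise [P] sits inside the existential so that [choice] yields a total function, to be
   iterated from the corner [(a, c)]. *)
have step (np : nat * (R * R)) : exists q : R * R, P np.1 np.2 ->
    [/\ P np.1.+1 q, np.2.1 <= q.1 <= np.2.1 + h / 2 ^+ np.1.+1 &
      np.2.2 <= q.2 <= np.2.2 + k / 2 ^+ np.1.+1].
  case: np => n [x y] /=.
  have [|nP] := pselect (P n (x, y)); last by exists (0, 0).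
  case=> /= ax xb cy yd; rewrite /P !half_eq.
  have hn : 0 <= h / 2 ^+ n by rewrite divr_ge0// exprn_ge0.
  have kn : 0 <= k / 2 ^+ n by rewrite divr_ge0// exprn_ge0.
  move: (h / 2 ^+ n) (k / 2 ^+ n) hn kn xb yd => h' k' hn kn xb yd Hb.
  have [ha hb hc hd] : [/\ x <= x + h' / 2, x + h' / 2 <= x + h',
      y <= y + k' / 2 & y + k' / 2 <= y + k'] by split; lra.
  have ax2 := le_trans ax ha; have cy2 := le_trans cy hc.
  have xb2 := le_trans hb xb; have yd2 := le_trans hd yd.
  pose E q := [/\ [/\ a <= q.1, q.1 + h' / 2 <= b, c <= q.2, q.2 + k' / 2 <= d &
      e * (h' / 2 + k' / 2) ^+ 2 <
      N q.1 (q.1 + h' / 2) q.2 (q.2 + k' / 2)],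
    x <= q.1 <= x + h' / 2 & y <= q.2 <= y + k' / 2].
  suff [q Eq] : exists q, E q by exists q => _.
  have e4 u v : u = x \/ u = x + h' / 2 -> v = y \/ v = y + k' / 2 ->
      e * (h' / 2 + k' / 2) ^+ 2 < N u (u + h' / 2) v (v + k' / 2) ->
      exists q, E q.
    move=> Hu Hv HN; exists (u, v); rewrite /E /=.
    have Hu' : x <= u <= x + h' / 2 by case: Hu => ->; lra.
    have Hv' : y <= v <= y + k' / 2 by case: Hv => ->; lra.
    by split=> //; split=> //; clear HN; lra.
  have hh : x + h' / 2 + h' / 2 = x + h' by lra.
  have kk : y + k' / 2 + k' / 2 = y + k' by lra.
  have [|N1] :=
    ltP (e * (h' / 2 + k' / 2) ^+ 2) (N x (x + h' / 2) y (y + k' / 2)).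
    by apply: e4; [left|left].
  have [|N2] := ltP (e * (h' / 2 + k' / 2) ^+ 2)
    (N (x + h' / 2) (x + h' / 2 + h' / 2) y (y + k' / 2)).
    by apply: e4; [right|left].
  have [|N3] := ltP (e * (h' / 2 + k' / 2) ^+ 2)
    (N x (x + h' / 2) (y + k' / 2) (y + k' / 2 + k' / 2)).
    by apply: e4; [left|right].
  have [|N4] := ltP (e * (h' / 2 + k' / 2) ^+ 2)
    (N (x + h' / 2) (x + h' / 2 + h' / 2) (y + k' / 2) (y + k' / 2 + k' / 2)).
    by apply: e4; [right|right].
  rewrite hh kk in N2 N3 N4.
  exfalso; move: Hb; apply/negP; rewrite -leNgt.
  have M1 := Nx _ _ _ _ _ ax ha hb xb cy hc yd2.
  have M2 := Nx _ _ _ _ _ ax ha hb xb cy2 hd yd.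
  have M3 := Ny _ _ _ _ _ ax (le_trans ha hb) xb cy hc hd yd.
  (* The bound is quadratic, hence exactly four times that of a quarter: if all four quarters
     satisfied it, so would the whole. *)
  have -> : e * (h' + k') ^+ 2 = 4 * (e * (h' / 2 + k' / 2) ^+ 2) by field.
  move: N1 N2 N3 N4 M1 M2 M3; lra.
have [F HF] := choice step.
pose s := fix s n := if n is m.+1 then F (m, s m) else (a, c).
have Ps n : P n (s n).
  elim: n => [|n IH]; last by have [] := HF (n, s n) IH.
  by rewrite /P /= expr0 !divr1 !subrKC.
have sx n : (s n).1 <= (s n.+1).1 <= (s n).1 + h / 2 ^+ n.+1.
  by case: (HF (n, s n) (Ps n)).
have sy n : (s n).2 <= (s n.+1).2 <= (s n).2 + k / 2 ^+ n.+1.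
  by case: (HF (n, s n) (Ps n)).
have hn0 n : 0 <= h / 2 ^+ n by rewrite divr_ge0// exprn_ge0.
have kn0 n : 0 <= k / 2 ^+ n by rewrite divr_ge0// exprn_ge0.
have [X HX] := nested_intervals hn0 (half_eq h) sx.
have [Y HY] := nested_intervals kn0 (half_eq k) sy.
have Xab : a <= X <= b.
  have := HX 0%N; rewrite /= expr0 divr1 /h; lra.
have Ycd : c <= Y <= d.
  have := HY 0%N; rewrite /= expr0 divr1 /k; lra.
(* The violating rectangles shrink to [(X, Y)]; once both sides are below [r], the local bound
   contradicts the violation. *)
have [r r0 Hr] := Nloc X Y e Xab Ycd e0.
have [n hn] : exists n, (h + k) / 2 ^+ n < r.
  have [n _ Hn] : \forall n \near \oo, (h + k) / 2 ^+ n < r.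
    have : geometric (h + k) (2^-1 : R) n @[n --> \oo] --> 0.
      by apply: cvg_geometric; rewrite ger0_norm ?invr_ge0// invf_lt1// ltr1n.
    move/cvgrPdist_lt => /(_ r r0); apply: filterS => m.
    by rewrite sub0r normrN /geometric /= -exprVn; apply: le_lt_trans; exact: ler_norm.
  by exists n; apply: Hn => /=.
have [] := Ps n; move: (HX n) (HY n) => HXn HYn ax xb cy yd.
apply/negP; rewrite -leNgt.
rewrite mulrDl in hn.
move: (hn0 n) (kn0 n) => {hn0 kn0} hn0 kn0.
have := Hr _ _ _ _ ax HXn xb cy HYn yd.
have -> u v : u + v - u = v :> R by rewrite addrC addKr.
have -> u v : u + v - u = v :> R by rewrite addrC addKr.
by apply; move: hn hn0 kn0; move: (h / 2 ^+ n) (k / 2 ^+ n) => *; lra.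
Qed.

End Bisection.

(** * Contraction of a closed curve to a point of the disc *)

Section StarHomotopy.
Variables (R : realType) (rho : R) (z : R[i]) (gam dgam : R -> R[i]).
Variables (a b M : R).
Hypotheses (z_in : normc z < rho) (ab : a <= b).
Hypothesis gam_in : forall t, a <= t <= b -> normc (gam t) < rho.
Hypothesis gam_neq : forall t, a <= t <= b -> gam t - z != 0.
Hypothesis cgam : cont_on a b gam.
Hypothesis cdgam : cont_on a b dgam.
(** The only link between [gam] and [dgam]: both the integration of affine functions and the
    Lipschitz bound use this integrated form. *)
Hypothesis gam_int : forall t1 t2, a <= t1 -> t1 <= t2 -> t2 <= b ->
  cint t1 t2 dgam = gam t2 - gam t1.
Hypothesis gam_closed : gam a = gam b.
Hypothesis M_gam : forall t, a <= t <= b -> normc (gam t - z) <= M.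
Hypothesis M_dgam : forall t, a <= t <= b -> normc (dgam t) <= M.

Let kap t := dgam t / (gam t - z).

Hypothesis M_kap : forall t, a <= t <= b -> normc (kap t) <= M.

Let zeta (s t : R) := z + s%:C * (gam t - z).
(** Edges with [s] fixed keep the [dt] part of the form, edges with [t] fixed the [ds] part; [J] is
    the integral over the boundary of a rectangle. *)
Let A (g : R[i] -> R[i]) s t1 t2 := cint t1 t2 (fun t => g (zeta s t) * kap t).
Let B (g : R[i] -> R[i]) t s1 s2 :=
  cint s1 s2 (fun s => g (zeta s t) * (s%:C)^-1).
Let J g s1 s2 t1 t2 := A g s2 t1 t2 - A g s1 t1 t2 - (B g t2 s1 s2 - B g t1 s1 s2).
Let cont_disc (g : R[i] -> R[i]) :=
  forall w, normc w < rho -> {for w, continuous g}.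

Let M_ge0 : 0 <= M.
Proof. by rewrite (le_trans (normc_ge0 _) (M_gam (t := a) _))// lexx. Qed.

(** The disc is convex, and [zeta s t] lies on the segment from [z] to [gam t]. *)
Let zeta_in s t : 0 <= s <= 1 -> a <= t <= b -> normc (zeta s t) < rho.
Proof.
move=> /andP[s0 s1] /gam_in tin.
have -> : zeta s t = (1 - s)%:C * z + s%:C * gam t.
  by rewrite /zeta rmorphB/=; ring.
rewrite (le_lt_trans (ler_normcD _ _))// !normcM !normc_real !ger0_norm ?subr_ge0//.
pose m := Num.max (normc z) (normc (gam t)).
have mr : m < rho by rewrite gt_max z_in tin.
have zm : normc z <= m by rewrite le_max lexx.
have gm : normc (gam t) <= m by rewrite le_max lexx orbT.
apply: le_lt_trans mr.
have -> : m = (1 - s) * m + s * m by ring.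
by rewrite lerD// ler_wpM2l// subr_ge0.
Qed.

Let ckap : cont_on a b kap.
Proof.
apply: cont_onM => //; apply: cont_onV => //.
by apply: cont_onD => //; exact: cont_on_cst.
Qed.

Let czeta s : cont_on a b (zeta s).
Proof.
apply: cont_onD; first exact: cont_on_cst.
apply: cont_onM; first exact: cont_on_cst.
by apply: cont_onD => //; exact: cont_on_cst.
Qed.

Let cA g s : cont_disc g -> 0 <= s <= 1 ->
  cont_on a b (fun t => g (zeta s t) * kap t).
Proof.
move=> cg s01; apply: cont_onM => //; apply: cont_on_comp => // t tab.
by apply: cg; exact: zeta_in.
Qed.

Let cB g s1 s2 t : cont_disc g -> 0 < s1 -> s2 <= 1 -> a <= t <= b ->
  cont_on s1 s2 (fun s => g (zeta s t) * (s%:C)^-1).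
Proof.
move=> cg s0 s21 tab.
have cid : cont_on s1 s2 (fun s => s%:C).
  by split=> x _; exact: continuous_real_complex.
apply: cont_onM; last first.
  apply: cont_onV => // x /andP[s1x _].
  by rewrite -normc_eq0 normc_real normr_eq0 gt_eqF// (lt_le_trans s0).
apply: (@cont_on_comp _ _ _ (fun s => zeta s t) g).
  apply: cont_onD; first exact: cont_on_cst.
  by apply: cont_onM => //; exact: cont_on_cst.
move=> x /andP[s1x xs2]; apply: cg; apply: zeta_in => //.
by rewrite (le_trans (ltW s0) s1x) (le_trans xs2 s21).
Qed.

(** The edge at [s2], shared by the two pieces, is run in opposite directions and cancels. *)
Let J_addl g s1 s2 s3 t1 t2 : cont_disc g -> 0 < s1 -> s1 <= s2 -> s2 <= s3 ->
  s3 <= 1 -> a <= t1 -> t1 <= t2 -> t2 <= b ->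
  J g s1 s3 t1 t2 = J g s1 s2 t1 t2 + J g s2 s3 t1 t2.
Proof.
move=> cg s10 s12 s23 s31 at1 t12 t2b; rewrite /J /B.
have t1ab : a <= t1 <= b by rewrite at1 (le_trans t12).
have t2ab : a <= t2 <= b by rewrite t2b (le_trans at1).
rewrite (cint_split s12 s23 (cB cg s10 s31 t1ab)).
rewrite (cint_split s12 s23 (cB cg s10 s31 t2ab)).
move: (cint _ _ _) (cint _ _ _) (cint _ _ _) (cint _ _ _) => p q p' q'.
move: (A _ _ _ _) (A _ _ _ _) (A _ _ _ _) => u v w; ring.
Qed.

Let J_addr g s1 s2 t1 t2 t3 : cont_disc g -> 0 < s1 -> s1 <= s2 ->
  s2 <= 1 -> a <= t1 -> t1 <= t2 -> t2 <= t3 -> t3 <= b ->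
  J g s1 s2 t1 t3 = J g s1 s2 t1 t2 + J g s1 s2 t2 t3.
Proof.
move=> cg s10 s12 s21 at1 t12 t23 t3b; rewrite /J /A.
have Hc s : 0 <= s <= 1 -> cont_on t1 t3 (fun t => g (zeta s t) * kap t).
  by move=> /(cA cg); apply: cont_onS.
have s1i : 0 <= s1 <= 1 by rewrite (ltW s10) (le_trans s12).
have s2i : 0 <= s2 <= 1 by rewrite s21 (le_trans (ltW s10)).
rewrite (cint_split t12 t23 (Hc _ s1i)) (cint_split t12 t23 (Hc _ s2i)).
move: (cint _ _ _) (cint _ _ _) (cint _ _ _) (cint _ _ _) => p q p' q'.
move: (B _ _ _ _) (B _ _ _ _) (B _ _ _ _) => u v w; ring.
Qed.

(* The error term [e] is what is left of [f] once an affine function is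
   subtracted; the contour integral of an affine function vanishes. *)
Let J_affine (f e : R[i] -> R[i]) c d s1 s2 t1 t2 :
  cont_disc f -> cont_disc e -> (forall w, f w = c + d * (w - z) + e w) ->
  0 < s1 -> s1 <= s2 -> s2 <= 1 -> a <= t1 -> t1 <= t2 -> t2 <= b ->
  J f s1 s2 t1 t2 = J e s1 s2 t1 t2.
Proof.
move=> cf ce fE s10 s12 s21 at1 t12 t2b.
have sub g : cont_on a b g -> cont_on t1 t2 g by apply: cont_onS.
(* By [zeta s t - z = s (gam t - z)] the linear term turns into [d s dgam], which [gam_int]
   integrates. *)
have As s : 0 <= s <= 1 -> A f s t1 t2 =
    c * cint t1 t2 kap + d * s%:C * (gam t2 - gam t1) + A e s t1 t2.
  move=> s01; rewrite -gam_int// -!cintZ; try exact: sub.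
  rewrite -cintD; try by apply: cont_onM; [exact: cont_on_cst|exact: sub].
  rewrite -cintD; last 2 first.
    by apply: cont_onD; apply: cont_onM; [exact: cont_on_cst|exact: sub|
      exact: cont_on_cst|exact: sub].
    by apply: sub; exact: cA.
  apply: eq_cint => t /andP[t1t tt2]; rewrite fE /kap /zeta.
  have := gam_neq (t := t); rewrite (le_trans at1 t1t) (le_trans tt2 t2b).
  by move=> /(_ isT) g0; field.
have s1C x : s1 <= x -> x%:C != 0 :> R[i].
  by move=> s1x; rewrite -normc_eq0 normc_real normr_eq0 gt_eqF// (lt_le_trans s10).
have Bt t : a <= t <= b -> B f t s1 s2 =
    c * cint s1 s2 (fun s => (s%:C)^-1) +
    (s2 - s1)%:C * (d * (gam t - z)) + B e t s1 s2.
  move=> tab; rewrite -cint_cst//.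
  have civ : cont_on s1 s2 (fun s => (s%:C)^-1).
    apply: cont_onV => [|x /andP[/s1C]//].
    by split=> x _; exact: continuous_real_complex.
  rewrite -cintZ// -cintD//; last 2 first.
    by apply: cont_onM => //; exact: cont_on_cst.
    exact: cont_on_cst.
  rewrite -cintD; last 2 first.
    apply: cont_onD; last exact: cont_on_cst.
    by apply: cont_onM => //; exact: cont_on_cst.
    exact: cB.
  apply: eq_cint => s /andP[/s1C s0 _]; rewrite fE /zeta.
  by field.
have t1ab : a <= t1 <= b by rewrite at1 (le_trans t12).
have t2ab : a <= t2 <= b by rewrite t2b (le_trans at1).
have s1i : 0 <= s1 <= 1 by rewrite (ltW s10) (le_trans s12).
have s2i : 0 <= s2 <= 1 by rewrite s21 (le_trans (ltW s10)).
(* The terms in [c] cancel between opposite edges; those in [d] give [d (s2 - s1) (gam t2 - gam t1)]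
   for both pairs of edges. *)
rewrite /J !As// !Bt// rmorphB/=; ring.
Qed.

(** The factor 2 is that of [cint_le], applied to [dgam]; the summand 1 keeps the constant
    positive. *)
Let zeta_lip s0 t0 s t : 0 <= s0 <= 1 -> a <= t0 <= b -> a <= t <= b ->
  normc (zeta s t - zeta s0 t0) <= (2 * M + 1) * (`|s - s0| + `|t - t0|).
Proof.
move=> /andP[s00 s01] t0ab tab.
have lip u v : a <= u <= b -> a <= v <= b -> u <= v ->
    normc (gam v - gam u) <= 2 * (v - u) * M.
  move=> /andP[au ub] /andP[av vb] uv; rewrite -gam_int//.
  apply: cint_le => //; first exact: cont_onS cdgam.
  by move=> x /andP[ux xv]; apply: M_dgam; rewrite (le_trans au ux) (le_trans xv vb).
have lip2 : normc (gam t - gam t0) <= 2 * `|t - t0| * M.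
  have [tt|/ltW tt] := leP t0 t.
    by rewrite ger0_norm ?subr_ge0// lip.
  by rewrite ler0_norm ?subr_le0// opprB normcB lip.
have -> : zeta s t - zeta s0 t0 =
    (s - s0)%:C * (gam t - z) + s0%:C * (gam t - gam t0).
  by rewrite /zeta rmorphB/=; ring.
rewrite (le_trans (ler_normcD _ _))// !normcM !normc_real (ger0_norm s00).
have H1 : `|s - s0| * normc (gam t - z) <= `|s - s0| * M by rewrite ler_wpM2l// M_gam.
have H2 : s0 * normc (gam t - gam t0) <= 2 * `|t - t0| * M.
  rewrite -[leRHS]mul1r ler_pM// normc_ge0//.
have n1 := normr_ge0 (s - s0); have n2 := normr_ge0 (t - t0).
have H3 : 0 <= `|s - s0| * M by rewrite mulr_ge0.
rewrite (le_trans (lerD H1 H2))//; lra.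
Qed.

(** Once the affine part is removed, the function has size [e D] up to constants on a rectangle
    whose sides add up to [D], and each edge has length at most [D]. The kernels are at most [M] and
    [sig^-1], which is why [s] must stay away from 0. *)
Let J_local (f : R[i] -> R[i]) d (sig s0 t0 e : R) : cont_disc f ->
  0 < sig -> sig <= s0 <= 1 -> a <= t0 <= b ->
  cderiv f (zeta s0 t0) d -> 0 < e ->
  exists2 r : R, 0 < r & forall s1 s2 t1 t2, sig <= s1 -> s1 <= s0 <= s2 ->
    s2 <= 1 -> a <= t1 -> t1 <= t0 <= t2 -> t2 <= b ->
    s2 - s1 < r -> t2 - t1 < r ->
    normc (J f s1 s2 t1 t2) <= e * (s2 - s1 + (t2 - t1)) ^+ 2.
Proof.
move=> cf sig0 s0i t0i df e0.
have s00 : 0 <= s0 <= 1 by case/andP: s0i => h ->; rewrite (le_trans (ltW sig0)).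
(* In [K], 4 counts two opposite edges times the factor 2 of [cint_le], and [L] comes from
   [zeta_lip]. *)
pose L := 2 * M + 1; pose K := 4 * L * (M + sig^-1).
have L0 : 0 < L by rewrite /L; move: M_ge0; lra.
have isig : 0 < sig^-1 by rewrite invr_gt0.
have K0 : 0 < K by rewrite /K !mulr_gt0// ltr_wpDl.
have [r r0 Hr] := df _ (divr_gt0 e0 K0).
(* Sides shorter than [r / (2 L)] keep [zeta] within [r] of [zeta s0 t0]. *)
exists (r / (2 * L)) => [|s1 s2 t1 t2 sigs1]; first by rewrite divr_gt0// mulr_gt0.
move=> /andP[s1s s2s] s2l at1 /andP[t1t tt2] t2b ds dt.
have s10 : 0 < s1 := lt_le_trans sig0 sigs1.
have s12 := le_trans s1s s2s; have t12 := le_trans t1t tt2.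
pose w0 := zeta s0 t0.
pose er w := f w - f w0 - d * (w - w0).
have cer : cont_disc er.
  move=> w wr; have F := nbhs_filter w.
  have cB1 : (fun x => f x - f w0) @ w --> f w - f w0.
    by apply: (@cvgB _ _ _ _ F); [exact: cf|exact: (@cvg_cst _ _ _ _ F)].
  have cB2 : (fun x => d * (x - w0)) @ w --> d * (w - w0).
    apply: (@cvgM _ _ _ F); first exact: (@cvg_cst _ _ _ _ F).
    by apply: (@cvgB _ _ _ _ F); [exact: cvg_id|exact: (@cvg_cst _ _ _ _ F)].
  exact: (@cvgB _ _ _ _ F _ _ _ _ cB1 cB2).
(* [J_affine] wants the affine function centred at [z], whereas the derivative is taken at [w0]. *)
have fE w : f w = (f w0 + d * (z - w0)) + d * (w - z) + er w.
  by rewrite /er; ring.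
rewrite (J_affine cf cer fE)//.
pose D := s2 - s1 + (t2 - t1).
have D0 : 0 <= D by rewrite addr_ge0 ?subr_ge0.
pose eta := e / K * (L * D).
have eK : 0 < e / K by rewrite divr_gt0.
have eta0 : 0 <= eta by rewrite mulr_ge0 ?(ltW eK)// mulr_ge0// ltW.
have Her s t : s1 <= s <= s2 -> t1 <= t <= t2 -> normc (er (zeta s t)) <= eta.
  move=> /andP[s1s' ss2'] /andP[t1t' tt2'].
  have tab : a <= t <= b by rewrite (le_trans at1)//= (le_trans tt2').
  have zl : normc (zeta s t - w0) <= L * D.
    rewrite (le_trans (zeta_lip _ _ t0i _))// ler_pM2l//.
    by rewrite /D lerD// ler_norml; apply/andP; split; lra.
  rewrite (le_trans (Hr _ _))//.
    rewrite (le_lt_trans zl)//.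
    have : D < r / (2 * L) + r / (2 * L) by rewrite ltrD.
    rewrite (_ : r / _ + _ = r / L); last by field; rewrite gt_eqF.
    by rewrite ltr_pdivlMr// mulrC.
  by rewrite ler_pM2l// divr_gt0.
have HA s : s1 <= s <= s2 -> 0 <= s <= 1 ->
    normc (A er s t1 t2) <= 2 * (t2 - t1) * (eta * M).
  move=> ss s01; apply: cint_le => //.
    by apply: cont_onS (cA cer s01).
  move=> t tt; rewrite normcM ler_pM ?normc_ge0//; first exact: Her.
  by apply: M_kap; case/andP: tt => ? ?; rewrite (le_trans at1)//= (le_trans _ t2b).
have HB t : t1 <= t <= t2 -> normc (B er t s1 s2) <= 2 * (s2 - s1) * (eta * sig^-1).
  move=> tt; apply: cint_le => //.
    apply: cB => //.
    by case/andP: tt => ? ?; rewrite (le_trans at1)//= (le_trans _ t2b).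
  move=> s ss; rewrite normcM ler_pM ?normc_ge0//; first exact: Her.
  have s_gt0 : 0 < s by rewrite (lt_le_trans s10)//; case/andP: ss.
  rewrite normcV normc_real gtr0_norm// lef_pV2 ?posrE//.
  by rewrite (le_trans sigs1)//; case/andP: ss.
have s1i : 0 <= s1 <= 1 by rewrite (ltW s10) (le_trans s12).
have s2i : 0 <= s2 <= 1 by rewrite s2l (le_trans (ltW s10)).
have l1 : s1 <= s1 <= s2 by rewrite lexx.
have l2 : s1 <= s2 <= s2 by rewrite lexx andbT.
have l3 : t1 <= t1 <= t2 by rewrite lexx.
have l4 : t1 <= t2 <= t2 by rewrite lexx andbT.
have tri2 (u v : R[i]) : normc (u - v) <= normc u + normc v.
  by rewrite (le_trans (ler_normcD _ _))// normcN.
have tri (u v u' v' : R[i]) : normc (u - v - (u' - v')) <=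
    normc u + normc v + (normc u' + normc v').
  exact: le_trans (tri2 _ _) (lerD (tri2 _ _) (tri2 _ _)).
rewrite (le_trans (tri _ _ _ _))//.
rewrite (le_trans (lerD (lerD (HA _ l2 s2i) (HA _ l1 s1i))
  (lerD (HB _ l4) (HB _ l3))))//.
have -> : e * (s2 - s1 + (t2 - t1)) ^+ 2 = 4 * eta * (M + sig^-1) * D.
  rewrite /eta /K -/D; field.
  rewrite !gt_eqF//=.
  by rewrite ltr_wpDl// mulr_ge0// ltW.
have ds0 : 0 <= s2 - s1 by rewrite subr_ge0.
have dt0 : 0 <= t2 - t1 by rewrite subr_ge0.
have em : 0 <= eta * M * (s2 - s1) := mulr_ge0 (mulr_ge0 eta0 M_ge0) ds0.
have es : 0 <= eta * sig^-1 * (t2 - t1) := mulr_ge0 (mulr_ge0 eta0 (ltW isig)) dt0.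
by rewrite /D; lra.
Qed.

(** The modulus of the additive [J] is a subadditive function of rectangles, and [J_local] bounds it
    near each point. *)
Let J_eq0 (f : R[i] -> R[i]) sig : (forall w, normc w < rho -> exists d, cderiv f w d) ->
  0 < sig -> sig <= 1 -> J f sig 1 a b = 0.
Proof.
move=> df sig0 sig1.
have cf : cont_disc f by move=> w /df[d]; exact: cderiv_continuous.
apply: eq0_normc; apply/eqP; rewrite eq_le normc_ge0 andbT.
apply: (@subadditive_rect_le0 _ (fun s1 s2 t1 t2 => normc (J f s1 s2 t1 t2))) => //.
- move=> s1 s2 s3 t1 t2 sg *; rewrite (@J_addl f s1 s2 s3)//.
  + exact: ler_normcD.
  + exact: lt_le_trans sg.
- move=> s1 s2 t1 t2 t3 sg *; rewrite (@J_addr f s1 s2 t1 t2 t3)//.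
  + exact: ler_normcD.
  + exact: lt_le_trans sg.
- move=> s0 t0 e s0i t0i e0.
  have [|d dfd] := df (zeta s0 t0).
    by apply: zeta_in => //; case/andP: s0i => h ->; rewrite (le_trans (ltW sig0)).
  exact: (J_local cf sig0 s0i t0i dfd e0).
Qed.

Lemma cauchy_star (f : R[i] -> R[i]) :
  (forall w, normc w < rho -> exists d, cderiv f w d) ->
  cint a b (fun t => f (gam t) * (dgam t / (gam t - z))) =
  f z * cint a b (fun t => dgam t / (gam t - z)).
Proof.
move=> df.
have cf : cont_disc f by move=> w /df[d]; exact: cderiv_continuous.
have Bab s1 s2 : B f a s1 s2 = B f b s1 s2.
  by apply: eq_cint => s _; rewrite /zeta gam_closed.
have A1 s : 0 < s <= 1 -> A f 1 a b = A f s a b.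
  move=> /andP[s0 s1]; have := J_eq0 df s0 s1.
  by rewrite /J Bab subrr subr0 => /eqP; rewrite subr_eq0 => /eqP.
have -> : cint a b (fun t => f (gam t) * (dgam t / (gam t - z))) = A f 1 a b.
  by apply: eq_cint => t _; rewrite /zeta mul1r subrKC.
apply/eqP; rewrite -subr_eq0 -normc_eq0 eq_le normc_ge0 andbT.
apply/ler_addgt0Pr => e e0; rewrite add0r.
pose C := 2 * (b - a) * M + 1.
have C0 : 0 < C by rewrite ltr_wpDl// !mulr_ge0// subr_ge0.
have /(cvg_normcP (nbhs_filter z)) /(_ (e / C)) := cf z z_in.
rewrite divr_gt0// => /(_ isT) /nbhs_normcP[r r0 Hr].
(* This [s] puts every [zeta s t] within [r] of [z]; one value of [s] for each [e] replaces a
   limit. *)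
pose s := Num.min 1 (r / (M + 1)).
have M10 : 0 < M + 1 by rewrite ltr_wpDl.
have s0 : 0 < s by rewrite lt_min ltr01 divr_gt0.
have s1 : s <= 1 by rewrite ge_min lexx.
have s01 : 0 <= s <= 1 by rewrite ltW.
rewrite (A1 s) ?s0// /A -cintZ//.
rewrite -[X in _ - X]mul1r -mulNr -cintZ; last first.
  by apply: cont_onM => //; exact: cont_on_cst.
rewrite -cintD; last 2 first.
- exact: cA.
- by do 2!(apply: cont_onM => //; first exact: cont_on_cst).
apply: (@le_trans _ _ (2 * (b - a) * (e / C * M))).
  apply: cint_le => //.
    apply: cont_onD; first exact: cA.
    by do 2!(apply: cont_onM => //; first exact: cont_on_cst).
  move=> t tab.
  have -> : f (zeta s t) * kap t + -1 * (f z * (dgam t / (gam t - z))) =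
    (f (zeta s t) - f z) * kap t by rewrite /kap; ring.
  rewrite normcM ler_pM ?normc_ge0// ?M_kap//.
  apply/ltW/Hr; rewrite /zeta addrAC subrr add0r normcM normc_real.
  rewrite gtr0_norm//.
  have : s * (M + 1) <= r by rewrite -ler_pdivlMr// ge_min lexx orbT.
  apply: lt_le_trans; rewrite ltr_pM2l//.
  by rewrite (le_lt_trans (M_gam tab))// ltrDl.
have -> : 2 * (b - a) * (e / C * M) = e * (2 * (b - a) * M) / C.
  by field; exact: lt0r_neq0.
by rewrite ler_pdivrMr// ler_pM2l// lerDl.
Qed.

End StarHomotopy.

(** * Cauchy's formula and estimates *)

Section CauchyFormula.
Variable R : realType.

(* [k = 1] is the circle run counterclockwise, [k = -1] clockwise. *)
Definition circle (r k t : R) : R[i] := (r * cos t) +i* (k * (r * sin t)).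

Lemma normc_circle (r k t : R) : 0 <= r -> k ^+ 2 = 1 -> normc (circle r k t) = r.
Proof.
move=> r0 k1; rewrite /circle /= !exprMn k1 mul1r -mulrDr cos2Dsin2 mulr1.
by rewrite sqrtr_sqr ger0_norm.
Qed.

Lemma circle_neq (r k t : R) z : 0 < r -> k ^+ 2 = 1 -> normc z < r ->
  circle r k t - z != 0.
Proof.
move=> r0 k1 zr; rewrite subr_eq0; apply/eqP => cz.
by move: zr; rewrite -cz normc_circle ?ltxx// ltW.
Qed.

Lemma cont_on_circle r k a b : cont_on a b (circle r k).
Proof.
split=> t _; apply/(cvg_ReIm (nbhs_filter t)); split => /=.
  by apply: cvgM; [exact: cvg_cst|exact: continuous_cos].
apply: cvgM; first exact: cvg_cst.
by apply: cvgM; [exact: cvg_cst|exact: continuous_sin].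
Qed.

(** For [k ^+ 2 = 1] the circle is [r e^{ikt}], whose velocity is [i k] times the position. *)
Lemma circle_int (r k t1 t2 : R) : t1 <= t2 -> k ^+ 2 = 1 ->
  cint t1 t2 (fun t => k *i * circle r k t) = circle r k t2 - circle r k t1.
Proof.
move=> t12 k1.
have dE t : k *i * circle r k t = (- (r * sin t)) +i* (k * (r * cos t)).
  apply/eqP; rewrite eq_complex /= !mul0r sub0r add0r.
  by rewrite [k * (k * _)]mulrA -expr2 k1 mul1r !eqxx.
have -> : (fun t => k *i * circle r k t) =
    (fun t => (- (r * sin t)) +i* (k * (r * cos t))).
  by apply/funext => t; exact: dE.
rewrite /cint /=.
have ccos : continuous (@cos R) := @continuous_cos R.
have csin : continuous (@sin R) := @continuous_sin R.
have cR : continuous (fun t : R => - (r * sin t)).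
  by move=> t; apply: cvgN; apply: cvgM; [exact: cvg_cst|exact: csin].
have cI : continuous (fun t : R => k * (r * cos t)).
  move=> t; apply: cvgM; first exact: cvg_cst.
  by apply: cvgM; [exact: cvg_cst|exact: ccos].
have dR (t : R) : is_derive t 1 (fun t => r * cos t) (- (r * sin t)).
  by rewrite -mulrN; apply: is_deriveZ.
have dI (t : R) : is_derive t 1 (fun t => k * (r * sin t)) (k * (r * cos t)).
  by apply: is_deriveZ; apply: is_deriveZ.
by rewrite (rint_FTC t12 cR dR) (rint_FTC t12 cI dI).
Qed.

Lemma circle_closed r k : circle r k 0 = circle r k (2 * pi).
Proof. by rewrite /circle sin0 cos0 mulr_natl cos2pi sin2pi. Qed.

Let twopi_ge0 : 0 <= 2 * pi :> R.
Proof. by rewrite mulr_ge0// pi_ge0. Qed.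

Lemma cauchy_circle (f : R[i] -> R[i]) (rho r k : R) z : 0 < r -> k ^+ 2 = 1 ->
  normc z < r -> r < rho ->
  (forall w, normc w < rho -> exists d, cderiv f w d) ->
  cint 0 (2 * pi) (fun t => f (circle r k t) * (circle r k t / (circle r k t - z)))
  = f z * cint 0 (2 * pi) (fun t => circle r k t / (circle r k t - z)).
Proof.
move=> r0 k1 zr rrho df.
pose g := circle r k.
have k0 : k *i != 0 :> R[i].
  rewrite eq_complex /= negb_and; apply/orP; right.
  by apply/eqP => k0; move: k1; rewrite k0 expr0n /= => /esym/eqP; rewrite oner_eq0.
have nk : normc (k *i) = 1 by rewrite /= expr0n /= add0r k1 sqrtr1.
have ng t : normc (g t) = r by rewrite normc_circle// ltW.
have gz t : r - normc z <= normc (g t - z).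
  rewrite -(ng t) lerBlDr; have := ler_normcD (g t - z) z.
  by rewrite subrK.
have rz : 0 < r - normc z by rewrite subr_gt0.
have q0 : 0 < r / (r - normc z) by rewrite divr_gt0.
have gz0 t : g t - z != 0 by apply: circle_neq.
have cg a b := cont_on_circle r k a b.
have czi a b : cont_on a b (fun t => (g t - z)^-1).
  apply: (@cont_onV _ _ _ (fun t => g t - z)) => [|t _]; last exact: gz0.
  by apply: cont_onD; [exact: cg|exact: cont_on_cst].
have cf a b : cont_on a b (fun t => f (g t)).
  apply: (@cont_on_comp _ _ _ g f); first exact: cg.
  by move=> t _; have [|d] := df (g t); rewrite ?ng//; exact: cderiv_continuous.
(* One [M] serves the three bounds asked by [cauchy_star]: on [gam - z], on [dgam] and on
   [dgam / (gam - z)]. *)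
pose M := r + normc z + r + r / (r - normc z).
have z0 := normc_ge0 z.
have M1 t : normc (g t - z) <= M.
  rewrite (le_trans (ler_normcD _ _))// normcN ng /M -addrA lerDl.
  by rewrite addr_ge0// ltW.
have M2 t : normc (k *i * g t) <= M.
  rewrite normcM nk mul1r ng /M -addrA -addrA lerDl.
  by rewrite !addr_ge0// ltW.
have M3 t : normc (k *i * g t / (g t - z)) <= M.
  rewrite normcM normcM nk mul1r ng normcV.
  rewrite (@le_trans _ _ (r / (r - normc z)))//.
    by rewrite ler_pM2l// lef_pV2 ?posrE// normc_gt0.
  by rewrite /M lerDr !addr_ge0// ltW.
have H := @cauchy_star R rho z g (fun t => k *i * g t) 0 (2 * pi) M
  (lt_trans zr rrho) twopi_ge0.
have {}H : cint 0 (2 * pi) (fun t => f (g t) * (k *i * g t / (g t - z))) =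
    f z * cint 0 (2 * pi) (fun t => k *i * g t / (g t - z)).
  apply: H => //.
  - by move=> t _; rewrite ng.
  - by apply: cont_onM; [exact: cont_on_cst|exact: cg].
  - by move=> t1 t2 _ t12 _; exact: circle_int.
  - exact: circle_closed.
have ckz : cont_on 0 (2 * pi) (fun t => g t / (g t - z)).
  by apply: cont_onM; [exact: cg|exact: czi].
(* The factor [k *i] of the velocity is common to both sides and drops out. *)
apply: (mulfI k0); rewrite mulrCA -(cintZ (k *i) ckz) -(cintZ (k *i)); last first.
  by apply: cont_onM; [exact: cf|exact: ckz].
rewrite (eq_cint (g2 := fun t => f (g t) * (k *i * g t / (g t - z)))); last first.
  by move=> t _; rewrite -/g; ring.
by rewrite H; congr (_ * _); apply: eq_cint => t _; rewrite mulrA.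
Qed.

(* [circle r 1 t / (circle r 1 t - z) = 1 / (1 - z w)], where [w] runs over the
   circle of radius [1 / r] clockwise: the mean value is that at [w = 0]. *)
Lemma cauchy_kernel_int (r : R) z : 0 < r -> normc z < r ->
  cint 0 (2 * pi) (fun t => circle r 1 t / (circle r 1 t - z)) = (2 * pi)%:C.
Proof.
move=> r0 zr; pose w t := circle r^-1 (-1) t.
have N1 : (-1) ^+ 2 = 1 :> R by rewrite sqrrN expr1n.
have z0 := normc_ge0 z.
have w0 t : w t != 0.
  by rewrite -[w t]subr0; apply: circle_neq; rewrite ?normc0 ?invr_gt0.
have wE t : w t * circle r 1 t = 1.
  apply/eqP; rewrite /w /circle eq_complex /=.
  have r1 : r != 0 by rewrite gt_eqF.
  have := cos2Dsin2 t; move: (cos t) (sin t) => c s cs.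
  apply/andP; split; apply/eqP.
    by transitivity (c ^+ 2 + s ^+ 2) => //; field.
  by field.
pose g x := (1 - z * x)^-1.
have rz : 0 < r + normc z by rewrite ltr_wpDr.
(* [2 / (r + |z|)] exceeds [1 / r], the radius of [w], yet [|z x| < 1] holds below it, so [g] has no
   pole there. *)
have dg x : normc x < 2 / (r + normc z) -> exists d, cderiv g x d.
  move=> xl; apply: derivable_cderiv; apply: derivableV.
    rewrite -normc_eq0 gt_eqF//.
    have : 1 <= normc (1 - z * x) + normc (z * x).
      by have := ler_normcD (1 - z * x) (z * x); rewrite subrK normc1.
    have : normc (z * x) < 1.
      rewrite normcM; move: xl; rewrite ltr_pdivlMr// mulrDr => xl.
      have : normc x * normc z <= normc x * r by rewrite ler_wpM2l ?normc_ge0// ltW.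
      lra.
    lra.
  apply: derivableB; first exact: derivable_cst.
  by apply: derivableM; [exact: derivable_cst|exact: derivable_id].
(* At the centre 0 the kernel [w / (w - 0)] is 1, so here the integral on the right is evident. *)
have := @cauchy_circle g (2 / (r + normc z)) r^-1 (-1) 0.
rewrite invr_gt0 normc0 N1 => /(_ r0 erefl); rewrite invr_gt0 => /(_ r0).
rewrite ltr_pdivlMr// ltr_pdivrMl// => H.
have {}H := H _ dg; rewrite -/(w _) in H.
have -> : cint 0 (2 * pi) (fun t => circle r 1 t / (circle r 1 t - z)) =
    cint 0 (2 * pi) (fun t => g (w t) * (w t / (w t - 0))).
  apply: eq_cint => t _; rewrite subr0 divff// mulr1 /g.
  have cz : circle r 1 t - z != 0 by apply: circle_neq; rewrite ?expr1n.
  have wc : circle r 1 t = (w t)^-1.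
    by apply: (mulfI (w0 t)); rewrite wE divff.
  rewrite wc in cz *.
  have -> : (w t)^-1 - z = (w t)^-1 * (1 - z * w t).
    by rewrite mulrBr mulr1 mulrCA mulVf// mulr1.
  by rewrite invfM mulrA divff ?mul1r// invr_eq0.
rewrite H; last by lra.
rewrite (eq_cint (g2 := fun=> 1)); last first.
  by move=> t _; rewrite subr0 divff// w0.
by rewrite cint_cst// subr0 mulr1 /g mulr0 subr0 invr1 mul1r.
Qed.

Lemma cauchy_formula (f : R[i] -> R[i]) (rho r : R) z : 0 < r ->
  normc z < r -> r < rho ->
  (forall w, normc w < rho -> exists d, cderiv f w d) ->
  cint 0 (2 * pi)
    (fun t => f (circle r 1 t) * (circle r 1 t / (circle r 1 t - z))) =
  (2 * pi)%:C * f z.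
Proof.
move=> r0 zr rrho df.
by rewrite (cauchy_circle r0 _ zr rrho df) ?expr1n// cauchy_kernel_int// mulrC.
Qed.

End CauchyFormula.

(** * Differentiation of Cauchy integrals and bounds on Taylor coefficients *)

Section CauchyDerivatives.
Variable R : realType.
Implicit Types (z w h : R[i]).

Lemma normc_nat n : normc (n%:R : R[i]) = n%:R :> R.
Proof.
by rewrite -(rmorph_nat (real_complex R)) normc_real ger0_norm// ler0n.
Qed.

(** Induction with the recursion [C' = B C + (n + 1) B^n]; it will be applied to the inverses of
    [u - w] and [u - z]. *)
Lemma exp_taylor2 (B : R) n : 0 <= B -> exists2 C : R, 0 <= C &
  forall p q : R[i], normc p <= B -> normc q <= B ->
  normc (p ^+ n.+1 - q ^+ n.+1 - n.+1%:R * q ^+ n * (p - q)) <=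
  C * normc (p - q) ^+ 2.
Proof.
move=> B0; elim: n => [|n [C C0 IH]].
  exists 0 => // p q _ _.
  by rewrite !expr1 expr0 !mulr1 mul1r subrr normc0 mul0r.
exists (B * C + n.+1%:R * B ^+ n) => [|p q pB qB].
  by rewrite addr_ge0// mulr_ge0// exprn_ge0.
have -> : p ^+ n.+2 - q ^+ n.+2 - n.+2%:R * q ^+ n.+1 * (p - q) =
    p * (p ^+ n.+1 - q ^+ n.+1 - n.+1%:R * q ^+ n * (p - q)) +
    n.+1%:R * q ^+ n * (p - q) ^+ 2.
  rewrite -[n.+2%:R]natr1 !exprS; move: (n.+1%:R) => c; ring.
rewrite (le_trans (ler_normcD _ _))// mulrDl -[B * C * _]mulrA lerD//.
  by rewrite normcM ler_pM ?normc_ge0// IH.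
rewrite normcM (normcM n.+1%:R) !normcX normc_nat ler_wpM2r ?exprn_ge0 ?normc_ge0//.
by rewrite ler_wpM2l// lerXn2r// nnegrE ?normc_ge0.
Qed.

(** The bound is uniform in [u], so that it can be integrated over the circle. It combines
    [exp_taylor2] for [p = 1 / (u - w)] and [q = 1 / (u - z)] with the identity
    [p - q - (w - z) q^2 = (w - z)^2 p q^2]. *)
Lemma cauchy_kernel_derive (r : R) z n : normc z < r ->
  exists2 C : R, 0 <= C & forall u w, normc u = r ->
    normc (w - z) < (r - normc z) / 2 ->
  normc ((u - w)^-1 ^+ n.+1 - (u - z)^-1 ^+ n.+1 -
         n.+1%:R * (u - z)^-1 ^+ n.+2 * (w - z)) <= C * normc (w - z) ^+ 2.
Proof.
(* Half the distance from [z] to the circle: [u - z] and [u - w] then have modulus at least [d]. *)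
move=> zr; pose d := (r - normc z) / 2.
have d0 : 0 < d by rewrite divr_gt0// subr_gt0.
pose B := d^-1; have B0 : 0 < B by rewrite invr_gt0.
have Bn k : 0 <= B ^+ k := exprn_ge0 k (ltW B0).
have [C C0 HC] := exp_taylor2 n (ltW B0).
exists (C * B ^+ 4 + n.+1%:R * B ^+ n.+3) => [|u w ur wz].
  by rewrite addr_ge0// mulr_ge0.
have uz : d <= normc (u - z).
  have := ler_normcD (u - z) z; rewrite subrK ur => h1.
  by have := normc_ge0 z; move: d0; rewrite /d; lra.
have uw : d <= normc (u - w).
  have := ler_normcD (u - w) (w - z); rewrite addrA subrK => h2.
  have := ler_normcD (u - z) z; rewrite subrK ur => h1.
  by move: wz d0 h1 h2; rewrite /d; lra.
have uz0 : u - z != 0 by rewrite -normc_eq0 gt_eqF// (lt_le_trans d0).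
have uw0 : u - w != 0 by rewrite -normc_eq0 gt_eqF// (lt_le_trans d0).
pose p := (u - w)^-1; pose q := (u - z)^-1; rewrite -/p -/q.
have pB : normc p <= B by rewrite normcV lef_pV2 ?posrE// normc_gt0.
have qB : normc q <= B by rewrite normcV lef_pV2 ?posrE// normc_gt0.
have pq : p - q = (w - z) * p * q.
  by rewrite /p /q; field; apply/andP.
have pq2 : p - q - (w - z) * q ^+ 2 = (w - z) ^+ 2 * p * q ^+ 2.
  by rewrite /p /q; field; apply/andP.
have -> : p ^+ n.+1 - q ^+ n.+1 - n.+1%:R * q ^+ n.+2 * (w - z) =
    (p ^+ n.+1 - q ^+ n.+1 - n.+1%:R * q ^+ n * (p - q)) +
    n.+1%:R * q ^+ n * (p - q - (w - z) * q ^+ 2).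
  by rewrite !exprS; ring.
have nwz := normc_ge0 (w - z).
rewrite (le_trans (ler_normcD _ _))// [leRHS]mulrDl lerD//.
  rewrite (le_trans (HC _ _ pB qB))// -mulrA ler_wpM2l// pq.
  rewrite !normcM exprMn exprMn -mulrA mulrC ler_wpM2r ?exprn_ge0//.
  have -> : B ^+ 4 = B ^+ 2 * B ^+ 2 by rewrite -exprD.
  by rewrite ler_pM ?exprn_ge0 ?normc_ge0// lerXn2r// nnegrE ?normc_ge0// ltW.
rewrite pq2 normcM (normcM n.+1%:R) (normcM _ (q ^+ 2)) (normcM _ p).
rewrite !normcX normc_nat.
have -> : n.+1%:R * normc q ^+ n * (normc (w - z) ^+ 2 * normc p * normc q ^+ 2) =
  n.+1%:R * (normc p * normc q ^+ n.+2) * normc (w - z) ^+ 2.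
  by rewrite !exprS; ring.
rewrite ler_wpM2r ?exprn_ge0// ler_wpM2l// [B ^+ n.+3]exprS.
by rewrite ler_pM ?exprn_ge0 ?normc_ge0// lerXn2r// nnegrE ?normc_ge0// ltW.
Qed.

Let twopi_ge0 : 0 <= 2 * pi :> R.
Proof. by rewrite mulr_ge0// pi_ge0. Qed.

Variables (r : R) (phi : R -> R[i]) (Phi : R).
Hypothesis r_gt0 : 0 < r.
Hypothesis cphi : cont_on 0 (2 * pi) phi.
Hypothesis phi_le : forall t, 0 <= t <= 2 * pi -> normc (phi t) <= Phi.

Let u t := circle r 1 t.

(** Differentiating [phi / (u - z)] in [z] [m] times gives this integrand. *)
Definition cauchy_int m z :=
  cint 0 (2 * pi) (fun t => m`!%:R * (phi t * (u t - z)^-1 ^+ m.+1)).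

Let nu t : normc (u t) = r.
Proof. by rewrite normc_circle ?expr1n// ltW. Qed.

Let cker n z : normc z < r ->
  cont_on 0 (2 * pi) (fun t => phi t * (u t - z)^-1 ^+ n).
Proof.
move=> zr; apply: (cont_onM cphi).
apply: (@cont_onX _ _ _ (fun t => (u t - z)^-1)).
apply: (@cont_onV _ _ _ (fun t => u t - z)) => [|t _].
  by apply: cont_onD; [exact: cont_on_circle|exact: cont_on_cst].
by apply: circle_neq; rewrite ?expr1n.
Qed.

Let Phi_ge0 : 0 <= Phi.
Proof. by rewrite (le_trans (normc_ge0 _) (phi_le (t := 0) _))// lexx. Qed.

(** Differentiation under the integral sign: the remainder is at most [K |w - z|^2], hence at most
    [e |w - z|] for [|w - z| < e / (K + 1)]. *)
Lemma cderiv_cauchy_int m z : normc z < r ->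
  cderiv (cauchy_int m) z (cauchy_int m.+1 z).
Proof.
move=> zr e e0.
have [C C0 HC] := cauchy_kernel_derive m zr.
pose K := 2 * (2 * pi - 0) * (m`!%:R * (Phi * C)).
have K0 : 0 <= K by rewrite mulr_ge0 ?mulr_ge0// subr0.
have K10 : 0 < K + 1 by rewrite ltr_wpDl.
have d0 : 0 < (r - normc z) / 2 by rewrite divr_gt0// subr_gt0.
exists (Num.min ((r - normc z) / 2) (e / (K + 1))).
  by rewrite lt_min d0 divr_gt0.
move=> w; rewrite lt_min => /andP[wz we].
have wr : normc w < r.
  have := ler_normcD (w - z) z; rewrite subrK.
  by move: wz d0; lra.
have cm c n y : normc y < r ->
    cont_on 0 (2 * pi) (fun t => c * (phi t * (u t - y)^-1 ^+ n)).
  by move=> yr; apply: cont_onM; [exact: cont_on_cst|exact: cker].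
have -> : cauchy_int m w - cauchy_int m z - cauchy_int m.+1 z * (w - z) =
   cint 0 (2 * pi) (fun t => m`!%:R * phi t * ((u t - w)^-1 ^+ m.+1 -
     (u t - z)^-1 ^+ m.+1 - m.+1%:R * (u t - z)^-1 ^+ m.+2 * (w - z))).
  have lin (x y k s : R[i]) : x - y - k * s = x + -1 * y + - s * k by ring.
  rewrite lin {lin}.
  rewrite /cauchy_int -(cintZ _ (cm _ _ _ zr)) -(cintZ _ (cm _ _ _ zr)).
  have c1 : cont_on 0 (2 * pi)
      (fun t => -1 * (m`!%:R * (phi t * (u t - z)^-1 ^+ m.+1))).
    by apply: cont_onM; [exact: cont_on_cst|exact: cm].
  have c2 : cont_on 0 (2 * pi)
      (fun t => - (w - z) * (m.+1`!%:R * (phi t * (u t - z)^-1 ^+ m.+2))).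
    by apply: cont_onM; [exact: cont_on_cst|exact: cm].
  rewrite -(cintD (cm _ _ _ wr) c1) -(cintD (cont_onD (cm _ _ _ wr) c1) c2).
  apply: eq_cint => t _; rewrite factS natrM.
  move: (_ ^+ m.+1) (_ ^+ m.+1) (_ ^+ m.+2) (m.+1%:R) (m`!%:R) => k1 k2 k3 c1' c2'.
  ring.
rewrite (@le_trans _ _ (K * normc (w - z) ^+ 2))//.
  rewrite /K -[leRHS]mulrA; apply: cint_le => //.
    have ck n y : normc y < r -> cont_on 0 (2 * pi) (fun t => (u t - y)^-1 ^+ n).
      move=> yr; apply: (@cont_onX _ _ _ (fun t => (u t - y)^-1)).
      apply: (@cont_onV _ _ _ (fun t => u t - y)) => [|t _].
        by apply: cont_onD; [exact: cont_on_circle|exact: cont_on_cst].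
      by apply: circle_neq; rewrite ?expr1n.
    apply: cont_onM.
      by apply: cont_onM; [exact: cont_on_cst|exact: cphi].
    have -> : (fun t => (u t - w)^-1 ^+ m.+1 - (u t - z)^-1 ^+ m.+1 -
        m.+1%:R * (u t - z)^-1 ^+ m.+2 * (w - z)) =
      (fun t => (u t - w)^-1 ^+ m.+1 + -1 * (u t - z)^-1 ^+ m.+1 +
        (- (m.+1%:R * (w - z))) * (u t - z)^-1 ^+ m.+2).
      by apply/funext => t; ring.
    apply: cont_onD; [apply: cont_onD|].
    - exact: ck.
    - by apply: cont_onM; [exact: cont_on_cst|exact: ck].
    - by apply: cont_onM; [exact: cont_on_cst|exact: ck].
  move=> t t2; rewrite normcM (normcM m`!%:R) normc_nat.
  rewrite -[leLHS]mulrA -[leRHS]mulrA ler_wpM2l// -[leRHS]mulrA.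
  by rewrite ler_pM ?normc_ge0 ?phi_le// HC// nu.
have nwz := normc_ge0 (w - z).
rewrite expr2 mulrA ler_wpM2r//.
move: we; rewrite ltr_pdivlMr//; lra.
Qed.

Lemma cauchy_int_le m : normc (cauchy_int m 0) <= 4 * pi * Phi * m`!%:R / r ^+ m.+1.
Proof.
have -> : 4 * pi * Phi * m`!%:R / r ^+ m.+1 =
    2 * (2 * pi - 0) * (m`!%:R * (Phi * (r ^+ m.+1)^-1)).
  by move: (m`!%:R) (_^-1) => p q; ring.
have z0 : normc (0 : R[i]) < r by rewrite normc0.
apply: cint_le => //.
  by apply: cont_onM; [exact: cont_on_cst|exact: cker].
move=> t t2; rewrite !normcM normc_nat normcX normcV subr0 nu exprVn.
by rewrite ler_wpM2l// ler_wpM2r ?phi_le// invr_ge0 exprn_ge0// ltW.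
Qed.

(** The induction runs over the whole open disc, since a derivative depends on nearby values;
    [r - |z|] keeps [w] inside. *)
Lemma derive1n_cauchy_int (f : R[i] -> R[i]) :
  (forall z, normc z < r -> f z = cauchy_int 0 z) ->
  forall m z, normc z < r -> derive1n m f z = cauchy_int m z.
Proof.
move=> fE; elim => [|m IH] z zr; first exact: fE.
rewrite derive1nS; apply: cderiv_derive1 => e e0.
have [d d0 Hd] := cderiv_cauchy_int m zr e0.
exists (Num.min d (r - normc z)) => [|w].
  by rewrite lt_min d0 subr_gt0.
rewrite lt_min => /andP[wd wr]; rewrite !IH//; first exact: Hd.
have := ler_normcD (w - z) z; rewrite subrK.
by move: wr; lra.
Qed.

End CauchyDerivatives.

Lemma continuous_normc_bounded (R : realType) (a b : R) (g : R -> R[i]) :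
  a <= b -> cont_on a b g -> exists M, forall t, a <= t <= b -> normc (g t) <= M.
Proof.
move=> ab [cg].
have cn : {within `[a, b], continuous (fun t => normc (g t))}.
  apply: continuous_in_subspaceT => x; rewrite inE/= in_itv/= => /cg gx.
  apply/cvgrPdist_lt => e e0.
  have /(_ e e0) := (cvg_normcP (nbhs_filter x) _ _).1 gx.
  apply: filterS => t; apply: le_lt_trans.
  have h1 := ler_normcD (g t - g x) (g x); rewrite subrK in h1.
  have h2 := ler_normcD (g x - g t) (g t); rewrite subrK normcB in h2.
  by rewrite ler_norml; apply/andP; split; lra.
have [c _ Hc] := EVT_max ab cn.
by exists (normc (g c)) => t tab; apply: Hc; rewrite in_itv.
Qed.

Lemma cauchy_estimate (R : realType) (f : R[i] -> R[i]) (rho r : R) :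
  0 < r -> r < rho -> (forall w, normc w < rho -> exists d, cderiv f w d) ->
  exists C, forall m, normc (derive1n m f 0 / m`!%:R) <= C / r ^+ m.
Proof.
move=> r0 rrho df.
have pi0 : 2 * pi != 0 :> R by rewrite mulf_neq0// gt_eqF// pi_gt0.
have ppi0 : 0 <= 2 * pi :> R by rewrite mulr_ge0// pi_ge0.
pose u t := circle r 1 t.
have nu t : normc (u t) = r by rewrite normc_circle ?expr1n// ltW.
(* The density absorbs [1 / (2 pi)] and the numerator of [u / (u - z)], so that Cauchy's formula
   reads [f = cauchy_int r phi 0]. *)
pose phi t := ((2 * pi)%:C)^-1 * (f (u t) * u t).
have cfu : cont_on 0 (2 * pi) (fun t => f (u t) * u t).
  apply: cont_onM; last exact: cont_on_circle.
  apply: (@cont_on_comp _ _ _ u f); first exact: cont_on_circle.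
  by move=> t _; have [|d] := df (u t); rewrite ?nu//; exact: cderiv_continuous.
have cphi : cont_on 0 (2 * pi) phi.
  by apply: cont_onM; [exact: cont_on_cst|exact: cfu].
have [Phi HPhi] := continuous_normc_bounded ppi0 cphi.
have fE z : normc z < r -> f z = cauchy_int r phi 0 z.
  move=> zr; have := cauchy_formula r0 zr rrho df.
  have C0 : (2 * pi)%:C != 0 :> R[i].
    by rewrite -normc_eq0 normc_real normr_eq0.
  move/(congr1 (fun x => ((2 * pi)%:C)^-1 * x)); rewrite mulKf// => <-.
  rewrite -cintZ; last first.
    under eq_fun do rewrite mulrA.
    apply: cont_onM; first exact: cfu.
    apply: (@cont_onV _ _ _ (fun t => u t - z)) => [|t _].
      by apply: cont_onD; [exact: cont_on_circle|exact: cont_on_cst].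
    by apply: circle_neq; rewrite ?expr1n.
  by apply: eq_cint => t _; rewrite fact0 mul1r expr1 /phi !mulrA.
exists (4 * pi * Phi / r) => m.
have m0 : 0 < m`!%:R :> R by rewrite ltr0n fact_gt0.
rewrite (derive1n_cauchy_int r0 cphi HPhi fE) ?normc0//.
rewrite normcM normcV normc_nat ler_pdivrMr//.
rewrite (le_trans (cauchy_int_le r0 cphi HPhi m))//.
by rewrite exprS invfM; lra.
Qed.

(** * Radius of convergence *)

(** [A] is a union of segments, images of [[0, 1]], which all contain [p]. *)
Lemma connected_star (R : realType) (p : R[i]) (A : set R[i]) : A p ->
  (forall w (t : R), A w -> 0 <= t <= 1 -> A (p + t%:C * (w - p))) -> connected A.
Proof.
move=> Ap star.
pose seg w := [set p + t%:C * (w - p) | t in `[0, 1]].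
have -> : A = \bigcup_(w in A) seg w.
  apply/seteqP; split=> [w Aw|_ [w Aw] [t t01 <-]].
    exists w => //; exists 1; first by rewrite /= in_itv/= ler01 lexx.
    by rewrite mul1r subrKC.
  by apply: star => //; move: t01; rewrite /= in_itv.
apply: bigcup_connected => [|w Aw].
  exists p => w Aw; exists 0; first by rewrite /= in_itv/= ler01 lexx.
  by rewrite mul0r addr0.
apply: connected_continuous_connected; first exact: segment_connected.
apply: continuous_subspaceT => t.
apply: cvgD; first exact: cvg_cst.
by apply: cvgM; [exact: continuous_real_complex|exact: cvg_cst].
Qed.

(* The plane without 0 is the union of two slit planes, star-shaped about 1
   and about 'i. *)
Lemma connected_setC0 (R : realType) : connected (~` [set (0 : R[i])]).
Proof.
pose U (p : R[i]) :=
  [set w | forall t : R, 0 <= t <= 1 -> p + t%:C * (w - p) != 0].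
have cU p : p != 0 -> connected (U p).
  move=> p0; apply: (@connected_star _ p) => [t _|w t Uw /andP[t0 t1] s /andP[s0 s1]].
    by rewrite subrr mulr0 addr0.
  have -> : p + s%:C * (p + t%:C * (w - p) - p) = p + (s * t)%:C * (w - p).
    by rewrite rmorphM/=; ring.
  by apply: Uw; rewrite mulr_ge0//= mulr_ile1.
have i0 : 'i != 0 :> R[i] by rewrite -normc_eq0 normc_i oner_eq0.
have -> : ~` [set (0 : R[i])] = U 1 `|` U 'i.
  apply/seteqP; split=> [w w0|w [|] Uw w0]; last 2 first.
  - by have := Uw 1; rewrite ler01 lexx w0 mul1r subrKC eqxx => /(_ isT).
  - by have := Uw 1; rewrite ler01 lexx w0 mul1r subrKC eqxx => /(_ isT).
  (* A point in neither set lies on the rays from 0 opposite to 1 and to ['i], which meet only at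
     0. *)
  apply: contrapT => /not_orP[/existsNP[t /not_implyP[_ /negP]]].
  rewrite negbK => /eqP Ht /existsNP[s /not_implyP[_ /negP]].
  rewrite negbK => /eqP Hs; apply: w0 => /=.
  move: w Ht Hs => [x y] [h1 h2] [h3 h4].
  rewrite !mul0r !(subr0, addr0, add0r) in h1 h2 h3 h4.
  have t0 : t != 0.
    by apply/eqP => t0; move: h1; rewrite t0 mul0r addr0 => /eqP; rewrite oner_eq0.
  have y0 : y = 0 by apply/eqP; move/eqP: h2; rewrite mulf_eq0 (negbTE t0).
  have s1 : s = 1 by move: h4; rewrite y0; lra.
  by move: h3; rewrite s1 mul1r y0 => ->.
apply: connectedU; [|exact: cU|exact: cU].
exists 1; split=> t.
  by rewrite subrr mulr0 addr0 oner_eq0.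
move=> _; rewrite eq_complex /= !mul0r !(subr0, addr0, add0r, mulr1) negb_and.
have [->|t0] := eqVneq t 0; last by [].
by rewrite !mul0r ?(oppr0, addr0, add0r, subr0) oner_eq0 ?orbT.
Qed.

(** * Lower bound for the radius *)

Section Radius.
Variable R : realType.
Implicit Types (a : nat -> R[i]) (z : R[i]).

Lemma cvg_series_complex a : cvgn (series (fun n => normc (a n))) -> cvgn (series a).
Proof.
move=> ca.
have cRe : cvgn (series (fun n => complex.Re (a n))).
  apply: normed_cvg; apply: series_le_cvg ca => n //=; first exact: normc_ge0.
  exact: ler_normc_Re.
have cIm : cvgn (series (fun n => complex.Im (a n))).
  apply: normed_cvg; apply: series_le_cvg ca => n //=; first exact: normc_ge0.
  exact: ler_normc_Im.
have sE n : series a n = (series (fun n => complex.Re (a n)) n) +i*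
                         (series (fun n => complex.Im (a n)) n).
  rewrite /series /=; elim: n => [|n IH]; first by rewrite !big_geq.
  by rewrite !big_nat_recr//= IH; case: (a n).
apply/cvg_ex; exists (limn (series (fun n => complex.Re (a n))) +i*
                      limn (series (fun n => complex.Im (a n)))).
rewrite (_ : series a = fun n => (series (fun n => complex.Re (a n)) n) +i*
                         (series (fun n => complex.Im (a n)) n)); last exact/funext.
by apply/cvg_ReIm; split.
Qed.

Lemma conv_radius_ge a z : cvgn [series a n * z ^+ n]_n ->
  ((normc z)%:E <= conv_radius a)%E.
Proof. by move=> cz; apply: ereal_sup_ubound; exists z. Qed.

Lemma conv_radius_ge0 a : (0 <= conv_radius a)%E.
Proof.
have := @conv_radius_ge a 0; rewrite normc0; apply.
apply/cvg_ex; exists (a 0%N).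
apply: cvg_near_cst; exists 1%N => // n /= n1.
rewrite /series /= big_ltn// expr0 mulr1 big_nat big1 ?addr0// => k /andP[k0 _].
by rewrite expr0n gtn_eqF// mulr0.
Qed.

Lemma conv_radius_ge_bounded a (C r : R) z : 0 < r -> normc z < r ->
  (forall n, normc (a n) <= C / r ^+ n) -> ((normc z)%:E <= conv_radius a)%E.
Proof.
move=> r0 zr aC; apply: conv_radius_ge; apply: cvg_series_complex.
have q0 : 0 <= normc z / r by rewrite divr_ge0 ?normc_ge0// ltW.
apply: (@series_le_cvg _ _ (geometric C (normc z / r))) => [n|n|n|].
- exact: normc_ge0.
- rewrite /geometric /= mulr_ge0 ?exprn_ge0//.
  by have := aC 0%N; rewrite expr0 divr1; apply: le_trans; exact: normc_ge0.
- rewrite /geometric /= normcM normcX expr_div_n mulrA mulrAC.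
  by rewrite ler_wpM2r ?exprn_ge0 ?normc_ge0.
- apply: is_cvg_geometric_series; rewrite ger0_norm// ltr_pdivrMr// mul1r//.
Qed.

Lemma lt_ereal_between (x : R) (r : \bar R) : (x%:E < r)%E ->
  exists2 y : R, x < y & (y%:E < r)%E.
Proof.
case: r => [r| |]//; rewrite ?lte_fin => xr.
- by exists ((x + r) / 2); rewrite ?lte_fin; lra.
- by exists (x + 1); rewrite ?ltry// ltrDl.
Qed.

Lemma conv_radius_taylor (Rad : \bar R) (f : hol_disc Rad) :
  (Rad <= conv_radius (taylor f))%E.
Proof.
case: f => [Rad0 a|f Rad0 hf]; first by apply: le_trans (conv_radius_ge0 _); rewrite Rad0.
rewrite leNgt; apply/negP.
set c := conv_radius _ => cRad.
have c0 : (0 <= c)%E := conv_radius_ge0 _.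
have [x xE] : exists x, c = x%:E.
  by case: c c0 cRad => [x| |]// _; [exists x|rewrite ltNge leey].
rewrite xE lee_fin in c0; rewrite xE in cRad.
(* Above the supposed radius and below [Rad]: [y] is where convergence will be shown, [r] the radius
   of the circle in Cauchy's formula, [rho] that of a disc of holomorphy. *)
have [y xy yR] := lt_ereal_between cRad.
have [r yr rR] := lt_ereal_between yR.
have [rho rrho rhoR] := lt_ereal_between rR.
have r0 : 0 < r by lra.
have df w : normc w < rho -> exists d, cderiv f w d.
  move=> wr; apply: derivable_cderiv; apply: (hf w).
  by rewrite /disc /=; apply: lt_trans rhoR; rewrite lte_fin.
have [C HC] := cauchy_estimate r0 rrho df.
have y0 : 0 <= y by lra.
have ny : normc (y%:C : R[i]) = y by rewrite normc_real ger0_norm.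
have := @conv_radius_ge_bounded (taylor (HolFun Rad0 hf)) C r y%:C r0.
rewrite ny => /(_ yr HC); rewrite -/c xE lee_fin; lra.
Qed.

(** * Universality at the origin and upper bound for the radius *)

Lemma le_homo_lt (lambda : nat -> nat) : {homo lambda : m n / (m < n)%N} ->
  forall n, (n <= lambda n)%N.
Proof.
by move=> H; elim=> // n IH; rewrite (leq_ltn_trans IH)// H.
Qed.

Lemma universal_at0 (mu : nat -> nat) (alpha : nat -> R[i]) (Rad : \bar R)
    (f : hol_disc Rad) : universal mu alpha f ->
  exists2 lambda : nat -> nat, (forall n, (n <= lambda n)%N) &
    normc (alpha (lambda n) * (taylor f (lambda n) * (lambda n)`!%:R) - 1)
      @[n --> \oo] --> (0 : R).
Proof.
move=> /(_ [set 0] (cst 1) (@compact_set1 _ _) (@connected_setC0 R)) [| |lam].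
- by apply: continuous_subspaceT; exact: cst_continuous.
- by move=> z _; exact: derivable_cst.
move=> [lam_incr _ lam0]; exists lam; first exact: le_homo_lt.
move: lam0; apply: cvg_trans; apply: near_eq_cvg; apply: nearW => n /=.
(* The supremum over [{0}] is the value at 0, where the partial sum reduces to its term of index 0,
   that is [n! a_n]. *)
rewrite image_set1 sup1 /partial_sum big_ord_recl big1 => [|k _]; last first.
  by rewrite exprS mul0r mulr0.
by rewrite addr0 expr0 mulr1 taylor_deriveE addn0 fact0 divr1.
Qed.

End Radius.

Theorem proposition5p4 (R : realType) (mu : nat -> nat) (alpha : nat -> R[i])
  (Rad : \bar R) (f : hol_disc Rad)
  (mu_incr : {homo mu : m n / (m < n)%N}) (mu_pos : forall n, (0 < mu n)%N)
  (alpha_neq0 : forall n, alpha n != 0)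
  (RadE : Rad = conv_radius (fun n => (n`!%:R * `|alpha n|)^-1))
  (grows : forall r : R, (Rad < r%:E)%E ->
     r ^+ n / (normc (alpha n) * n`!%:R) @[n --> \oo] --> +oo)
  (fW : universal mu alpha f) :
  conv_radius (taylor f) = Rad.
Proof.
apply/eqP; rewrite eq_le conv_radius_taylor andbT leNgt; apply/negP.
(* A point [z] of convergence with [|z| > Rad]; the growth hypothesis is used with [r = |z|]. *)
move=> /ereal_sup_gt[_ [z /= cz <-]] Rz.
have [lam lam_ge lam0] := universal_at0 fW.
(* Growth at least 2 and [|alpha_n a_n n!| > 1 / 2] make [|a_n z^n|] at least 1, whereas the terms
   of a convergent series fall below 1. *)
have /cvgryPge/(_ 2) [N1 _ H1] := grows _ Rz.
have /cvgrPdist_lt/(_ (1 / 2)) := lam0; case=> [|N2 _ H2]; first by rewrite divr_gt0.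
have := cvg_series_cvg_0 cz; move/(cvg_normcP _ _ _) => /(_ 1 ltr01) [N3 _ H3].
(* [N1] and [N3] are thresholds for the index [lam N], [N2] for [N] itself. *)
pose N := maxn N1 (maxn N2 N3).
have N1l : (N1 <= lam N)%N by rewrite (leq_trans _ (lam_ge _))// leq_maxl.
have N3l : (N3 <= lam N)%N by rewrite (leq_trans _ (lam_ge _))// !leq_max leqnn !orbT.
have N2N : (N2 <= N)%N by rewrite !leq_max leqnn orbT.
move: (H1 _ N1l) (H2 _ N2N) (H3 _ N3l) => /=.
set n := lam N; set a := taylor f n; rewrite subr0 sub0r normrN normcM normcX.
have f0 : 0 < n`!%:R :> R by rewrite ltr0n fact_gt0.
have al0 : 0 < normc (alpha n) by rewrite normc_gt0.
rewrite ger0_norm ?normc_ge0// => h1 h2 h3.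
have : 1 / 2 < normc (alpha n) * (normc a * n`!%:R).
  have := ler_normcD (alpha n * (a * n`!%:R)) (1 - alpha n * (a * n`!%:R)).
  by rewrite subrKC normc1 !normcM normc_nat normcB; lra.
move=> h4; move: h3; apply/negP; rewrite -leNgt.
have -> : normc a * normc z ^+ n = normc (alpha n) * (normc a * n`!%:R) *
    (normc z ^+ n / (normc (alpha n) * n`!%:R)).
  by field; rewrite !gt_eqF.
apply: (@le_trans _ _ (1 / 2 * 2)); first by lra.
by apply: ler_pM => //; exact: ltW.
Qed.
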